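(* Let $G$ be a (possibly infinite dimensional) Lie group in Milnor's sense, modeled over a Hausdorff locally convex vector space. If $G$ is locally $\mu$-convex, then $G$ has the strong Trotter property; that is, for each $\mu\in C^1([0,1],G)$ with $\mu(0)=e$ and $\dot\mu(0)\in \mathrm{dom}[\exp]$, we have $$\lim_{n\to\infty} \mu(\tau/n)^n=\exp(\tau\cdot \dot\mu(0))\qquad\text{for all } \tau\in [0,\ell],$$ uniformly in $\tau\in[0,\ell]$, for each $\ell>0$.
   Context: A Lie group $G$ in Milnor's sense is a group equipped with a smooth manifold structure modeled over a Hausdorff locally convex vector space $E$ (smoothness of maps between locally convex spaces in the Michal–Bastiani sense), such that the group multiplication and inversion are smooth. No completeness of $E$ and no regularity of $G$ is assumed. $e$ denotes the identity, $\mathfrak{g}=T_eG$ the Lie algebra, and $R_g\colon G\to G$, $h\mapsto h\cdot g$ the right translation. **Local $\mu$-convexity.** $G$ is locally $\mu$-convex if for each continuous seminorm $\mathfrak{u}$ on $E$ and each chart $\Xi\colon G\supseteq \mathcal{U}\to\mathcal{V}\subseteq E$ of $G$ with $e\in\mathcal{U}$ and $\Xi(e)=0$, there exists a continuous seminorm $\mathfrak{o}\geq\mathfrak{u}$ on $E$ such that for all $n\geq 1$ and all $X_1,\dots,X_n\in E$ with $\mathfrak{o}(X_1)+\dots+\mathfrak{o}(X_n)\leq 1$ one has (understood to include $X_1,\dots,X_n\in\mathcal{V}$) $\Xi^{-1}(X_1)\cdots\Xi^{-1}(X_n)\in\mathcal{U}$ and $$(\mathfrak{u}\circ\Xi)\big(\Xi^{-1}(X_1)\cdots\Xi^{-1}(X_n)\big)\leq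 \mathfrak{o}(X_1)+\dots+\mathfrak{o}(X_n).$$ **Exponential map.** The right logarithmic derivative of $\gamma\in C^1([0,1],G)$ is $\delta^r(\gamma)\in C^0([0,1],\mathfrak{g})$, $\delta^r(\gamma)(t)=d_{\gamma(t)}R_{\gamma(t)^{-1}}(\dot\gamma(t))$. A curve $\gamma\in C^1([0,1],G)$ with $\gamma(0)=e$ is uniquely determined by $\delta^r(\gamma)$. The set $\mathrm{dom}[\exp]$ consists of all $X\in\mathfrak{g}$ for which there exists $\gamma\in C^1([0,1],G)$ with $\gamma(0)=e$ and $\delta^r(\gamma)(t)=X$ for all $t\in[0,1]$; in this case $\exp(X):=\gamma(1)$. (One has $\mathbb{R}_{\geq 0}\cdot X\subseteq\mathrm{dom}[\exp]$ for each $X\in\mathrm{dom}[\exp]$, so that $\exp(\tau\cdot\dot\mu(0))$ is defined for $\tau\geq 0$.) **Uniform convergence.** A sequence of maps $\mu_n\in C^0([0,\ell],G)$ converges uniformly to $\mu\in C^0([0,\ell],G)$ if for each neighbourhood $U\subseteq G$ of $e$ there exists $n_U\in\mathbb{N}$ such that $\mu_n(t)\in U\cdot\mu(t)\cap\mu(t)\cdot U$ for all $n\geq n_U$ and $t\in[0,\ell]$. In the claim, this is applied to the maps $[0,\ell]\ni\tau\mapsto\mu(\tau/n)^n$, which are defined for $n\geq\ell$, and the map $[0,\ell]\ni \tau\mapsto \exp(\tau\cdot\dot\mu(0))$. *)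

(* Defs.v *)
From HB Require Import structures.
From mathcomp Require Import all_boot all_order all_algebra.
From mathcomp Require Import all_classical all_reals all_analysis.

Set Implicit Arguments.
Unset Strict Implicit.
Unset Printing Implicit Defensive.

Import Order.TTheory GRing.Theory Num.Theory.
Import numFieldNormedType.Exports.

Local Open Scope classical_set_scope.
Local Open Scope ring_scope.

Section MichalBastiani.
Context {R : realType} {E F : tvsType R}.
Implicit Types (f : E -> F) (U : set E).

(** The library's [derivable] and ['D_v f] require normed modules, and its [lim]
    a pointed type; hence this variant for locally convex spaces. The limit [l]
    is unique when [F] is Hausdorff, and [dderive] is [0] when there is none. *)
Definition has_dderive f (x v : E) (l : F) :=
  h^-1 *: (f (x + h *: v) - f x) @[h --> (0 : R)^'] --> l.

Definition dderive f (x v : E) : F := xget 0 [set l | has_dderive f x v l].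

(** [iter_dderive f [:: v1; ...; vk]] is [D_vk (... (D_v1 f))]. *)
Definition iter_dderive f (vs : seq E) : E -> F :=
  foldl (fun g v => dderive g ^~ v) f vs.

(** Smoothness of the restriction of [f] to [U], meant for [U] open: all iterated
    directional derivatives exist on [U], and the maps
    [(x, w1, ..., wk) |-> D_wk (... (D_w1 f)) x] are continuous on [U * E ^ k]
    (continuity at each point, this set being open). The values of [f] outside
    of [U] are irrelevant. *)
Definition smooth_on U f :=
  (forall (vs : seq E) (v x : E), U x ->
     exists l, has_dderive (iter_dderive f vs) x v l) /\
  (forall (k : nat) (x : E) (w : {ptws 'I_k -> E}), U x ->
     {for (x, w), continuous (fun p : E * {ptws 'I_k -> E} =>
        iter_dderive f [seq p.2 i | i <- enum 'I_k] p.1)}).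

End MichalBastiani.

Section Seminorm.
Context {R : realType} {E : tvsType R}.

Definition continuous_seminorm (p : E -> R) :=
  [/\ forall x y, p (x + y) <= p x + p y,
      forall (a : R) x, p (a *: x) = `|a| * p x &
      continuous p].

End Seminorm.

(** A chart [M >= cdom -> ccod <= E]; the values of the total functions [cmap]
    and [cinv] outside of [cdom] and [ccod] are irrelevant. *)
Record chart (R : realType) (M : topologicalType) (E : tvsType R) := Chart {
  cdom : set M;
  ccod : set E;
  cmap : M -> E;
  cinv : E -> M;
  cdom_open : open cdom;
  ccod_open : open ccod;
  cmap_ccod : forall p, cdom p -> ccod (cmap p);
  cinv_cdom : forall x, ccod x -> cdom (cinv x);
  cmapK : forall p, cdom p -> cinv (cmap p) = p;
  cinvK : forall x, ccod x -> cmap (cinv x) = x;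
  cmap_continuous : forall p, cdom p -> {for p, continuous cmap};
  cinv_continuous : forall x, ccod x -> {for x, continuous cinv}
}.

Section Manifold.
Context {R : realType}.

Definition smooth_in_charts {M N : topologicalType} {E F : tvsType R}
    (c : chart M E) (d : chart N F) (f : M -> N) :=
  smooth_on [set x | ccod c x /\ cdom d (f (cinv c x))]
            (fun x => cmap d (f (cinv c x))).

Definition compatible {M : topologicalType} {E : tvsType R} (c d : chart M E) :=
  smooth_in_charts c d id /\ smooth_in_charts d c id.

Definition smooth_map {M N : topologicalType} {E F : tvsType R}
    (A : set (chart M E)) (B : set (chart N F)) (f : M -> N) :=
  continuous f /\ forall c d, A c -> B d -> smooth_in_charts c d f.

Section ProductChart.
Context {M N : topologicalType} {E F : tvsType R}.
Variables (c : chart M E) (d : chart N F).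

Let dom : set (M * N) := cdom c `*` cdom d.
Let cod : set (E * F) := ccod c `*` ccod d.
Let map (p : M * N) := (cmap c p.1, cmap d p.2).
Let inv (x : E * F) := (cinv c x.1, cinv d x.2).

Let dom_open : open dom.
Proof.
rewrite openE => p [pc pd]; exists (cdom c, cdom d) => //.
by split; apply: open_nbhs_nbhs; split=> //; exact: cdom_open.
Qed.

Let cod_open : open cod.
Proof.
rewrite openE => x [xc xd]; exists (ccod c, ccod d) => //.
by split; apply: open_nbhs_nbhs; split=> //; exact: ccod_open.
Qed.

Let map_cod p : dom p -> cod (map p).
Proof. by case=> pc pd; split; exact: cmap_ccod. Qed.

Let inv_dom x : cod x -> dom (inv x).
Proof. by case=> xc xd; split; exact: cinv_cdom. Qed.

Let mapK p : dom p -> inv (map p) = p.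
Proof. by case: p => p q [/= pc qd]; rewrite /inv/= !cmapK. Qed.

Let invK x : cod x -> map (inv x) = x.
Proof. by case: x => x y [/= xc yd]; rewrite /map/= !cinvK. Qed.

Let map_continuous p : dom p -> {for p, continuous map}.
Proof.
case: p => p q [/= pc qd]; apply: cvg_pair => /=.
  by apply: (cvg_comp _ _ cvg_fst); exact: cmap_continuous.
by apply: (cvg_comp _ _ cvg_snd); exact: cmap_continuous.
Qed.

Let inv_continuous x : cod x -> {for x, continuous inv}.
Proof.
case: x => x y [/= xc yd]; apply: cvg_pair => /=.
  by apply: (cvg_comp _ _ cvg_fst); exact: cinv_continuous.
by apply: (cvg_comp _ _ cvg_snd); exact: cinv_continuous.
Qed.

Definition prod_chart : chart (M * N)%type (E * F)%type :=
  Chart dom_open cod_open map_cod inv_dom mapK invK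
        map_continuous inv_continuous.

End ProductChart.

Definition prod_atlas {M N : topologicalType} {E F : tvsType R}
    (A : set (chart M E)) (B : set (chart N F)) :
    set (chart (M * N)%type (E * F)%type) :=
  [set prod_chart c d | c in A & d in B].

End Manifold.

HB.structure Definition PreTopologicalGroup := {G of Topological G & Group G}.

(** The choice [chart_at] of a chart of the atlas around each point is used to
    identify each tangent space with the model space, see below. *)
HB.mixin Record isLieGroup (R : realType) (E : tvsType R) G
    & Topological G & Group G := {
  atlas : set (chart G E);
  chart_at : G -> chart G E;
  atlas_chart_at : forall g, atlas (chart_at g);
  mem_chart_at : forall g, cdom (chart_at g) g;
  atlas_compatible : forall c d, atlas c -> atlas d -> compatible c d;
  lie_group_hausdorff : hausdorff_space G;
  mulg_smooth :
    smooth_map (prod_atlas atlas atlas) atlas (fun p : G * G => (p.1 * p.2)%g);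
  invg_smooth : smooth_map atlas atlas (fun g : G => (g^-1)%g)
}.

#[short(type="lieGroupType")]
HB.structure Definition LieGroup (R : realType) (E : tvsType R) :=
  {G of isLieGroup R E G & Topological G & Group G}.

Section LieGroupDefs.
Context {R : realType} {E : tvsType R} {G : lieGroupType E}.
Implicit Types (gamma mu : R -> G) (X : E).

(** The charts of the maximal atlas. *)
Definition is_chart (c : chart G E) :=
  forall d, atlas d -> compatible c d.

(** Curves on [[0, 1]] are total functions on [R]; only their values on [[0, 1]]
    matter. The derivative is one-sided at the end points. *)
Definition has_cderive (f : R -> E) (t : R) (l : E) :=
  h^-1 *: (f (t + h) - f t)
    @[h --> within [set h | `[0, 1]%classic (t + h)] (0 : R)^'] --> l.

Definition cderive (f : R -> E) (t : R) : E := xget 0 [set l | has_cderive f t l].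

Definition C1_curve gamma :=
  {within `[0, 1], continuous gamma} /\
  forall c : chart G E, atlas c ->
    let S : set R := [set t : R | `[0, 1]%classic t /\ cdom c (gamma t)] in
    (forall t : R, S t -> exists l, has_cderive (cmap c \o gamma) t l) /\
    {within S, continuous (cderive (cmap c \o gamma))}.

(** Each tangent space [T_g G], and in particular the Lie algebra [T_e G], is
    identified with [E] through the chart [chart_at g]. *)
Definition velocity gamma (t : R) : E :=
  cderive (cmap (chart_at (gamma t)) \o gamma) t.

(** The tangent map [d_g f : T_g G -> T_(f g) G]. *)
Definition tangent_map (f : G -> G) (g : G) : E -> E :=
  dderive (fun x => cmap (chart_at (f g)) (f (cinv (chart_at g) x)))
          (cmap (chart_at g) g).

Definition right_translation (g : G) (h : G) : G := (h * g)%g.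

Definition rlogderive gamma (t : R) : E :=
  tangent_map (right_translation (gamma t)^-1%g) (gamma t) (velocity gamma t).

Definition exp_curve X gamma :=
  [/\ C1_curve gamma, gamma 0 = 1%g &
      forall t, `[0, 1]%classic t -> rlogderive gamma t = X].

Definition dom_exp : set E := [set X | exists gamma, exp_curve X gamma].

(** The value [gamma 1] does not depend on the curve [gamma]; [lie_exp X] is [1]
    for [X] outside of [dom_exp]. *)
Definition lie_exp X : G := xget 1%g [set gamma 1 | gamma in exp_curve X].

Definition uniform_cvg (l : R) (mu_ : nat -> R -> G) mu :=
  forall U : set G, nbhs 1%g U -> exists N : nat,
    forall (n : nat) (t : R), (N <= n)%N -> `[0, l]%classic t ->
      ([set (u * mu t)%g | u in U] `&` [set (mu t * u)%g | u in U]) (mu_ n t).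

End LieGroupDefs.

Arguments is_chart {R E} G c.
Arguments dom_exp {R E} G.

Section Properties.
Context {R : realType} {E : tvsType R} (G : lieGroupType E).

Definition locally_mu_convex :=
  forall (u : E -> R) (c : chart G E),
    continuous_seminorm u -> is_chart G c -> cdom c 1%g -> cmap c 1%g = 0 ->
  exists o : E -> R,
    [/\ continuous_seminorm o, forall x, u x <= o x &
        forall (n : nat) (X : 'I_n -> E), (1 <= n)%N ->
          \sum_(i < n) o (X i) <= 1 ->
          let P := (\prod_(i < n) cinv c (X i))%g in
          [/\ forall i, ccod c (X i), cdom c P &
              u (cmap c P) <= \sum_(i < n) o (X i)]].

(** [mu (tau / n)] is only meaningful for [n >= tau], which holds for all
    [tau] in [[0, l]] as soon as [n >= l]. *)
Definition strong_trotter :=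
  forall mu : R -> G, C1_curve mu -> mu 0 = 1%g ->
    dom_exp G (velocity mu 0) ->
  forall l : R, 0 < l ->
    uniform_cvg l (fun n tau => (mu (tau / n%:R)%R ^+ n)%g)
                  (fun tau => lie_exp (tau *: velocity mu 0)).

End Properties.

(* Main.v *)
Require Import Defs.
From HB Require Import structures.
From mathcomp Require Import all_boot all_order all_algebra.
From mathcomp Require Import all_classical all_reals all_analysis.
From mathcomp Require Import ring lra.

(** The idea is to write the error of the Trotter product as one product of many
    small group elements, and to let local mu-convexity bound that product.

    Let [X] be the velocity of [mu] at [0] and [Phi] the one-parameter semigroup
    generated by [X], so that [lie_exp (tau *: X) = Phi tau]. With [h = tau / n],
    [a = mu h] and [b = Phi h], telescoping ([expg_quotient]) gives

      a ^+ n * (b ^+ n)^-1 = \prod_(i < n) b ^+ i * (a * b^-1) * (b ^+ i)^-1,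

    and [b ^+ i = Phi (i * h)] stays on the compact curve [Phi `[0, l]]. Since [mu]
    and [Phi] have the same velocity at [0], the element [a * b^-1] is [o(h)] in a
    chart at [1], and so are its conjugates, uniformly over that compact curve
    ([compact_conj_small]). So the [n] factors have total size [n * o(tau / n)],
    which tends to [0] uniformly in [tau], and by local mu-convexity their product
    tends to [1] ([mu_convex_nbhs]). As [b ^+ n = Phi tau], this is the assertion
    for the neighbourhoods [U * Phi tau]; those of the form [Phi tau * U] follow by
    compactness ([compact_near_conj_nbhs]).

    Two ingredients have to be provided. The first is a first order calculus in
    the group. Smoothness yields the strict differentiability of maps in charts
    ([smooth_on_cvg_quotient]), by a mean value inequality for seminorms, which
    also works without completeness of the model space. It gives the rules for
    elements that are of the form [h *: v + o(h)] in a chart at [1]: products,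
    inverses, and conjugation by elements that may themselves vary.

    The second is the existence of [Phi], since only a curve on [[0, 1]] with
    logarithmic derivative [X] is given. A curve whose increments vanish to first
    order is constant ([infinitesimal_constant]); this, too, follows from local
    mu-convexity, applied to the increments over a fine subdivision. Hence curves
    with a given generator are unique, so that they are additive
    ([has_generatorD]), and powers extend them to all intervals
    ([has_generator_extend]). Uniqueness also makes [lie_exp] independent of the
    choice of a curve ([lie_exp_generator]). *)

Set Implicit Arguments.
Unset Strict Implicit.
Unset Printing Implicit Defensive.

Import Order.TTheory GRing.Theory Num.Theory.
Import numFieldNormedType.Exports.

Local Open Scope classical_set_scope.
Local Open Scope ring_scope.

(** * Locally convex spaces and continuous seminorms *)

Lemma eq_cvg_to {T : Type} {U : topologicalType} (Fl : set_system T) (f g : T -> U) (l : U) :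
  f =1 g -> f @ Fl --> l -> g @ Fl --> l.
Proof. by move=> /funext ->. Qed.

Section TvsLimits.
Context {R : realType} {E : tvsType R} {T : Type} {F : set_system T}.
Context {FF : Filter F}.
Implicit Types (f g : T -> E) (k : T -> R).

Lemma tvs_cvgD f g a b :
  f @ F --> a -> g @ F --> b -> (fun t => f t + g t) @ F --> a + b.
Proof.
move=> fa gb; apply: (cvg_comp2 fa gb).
exact: (@add_continuous E (a, b)).
Qed.

Lemma tvs_cvgZ k f (c : R) a :
  k @ F --> c -> f @ F --> a -> (fun t => k t *: f t) @ F --> c *: a.
Proof.
move=> kc fa; apply: (cvg_comp2 kc fa).
exact: (@scale_continuous R E (c, a)).
Qed.

Lemma tvs_cvgN f a : f @ F --> a -> (fun t => - f t) @ F --> - a.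
Proof. by move=> fa; apply: (cvg_comp _ _ fa); exact: opp_continuous. Qed.

Lemma tvs_cvgB f g a b :
  f @ F --> a -> g @ F --> b -> (fun t => f t - g t) @ F --> a - b.
Proof. by move=> fa gb; apply: tvs_cvgD => //; exact: tvs_cvgN. Qed.

End TvsLimits.

Section SeminormTheory.
Context {R : realType} {E : tvsType R}.
Implicit Types p : E -> R.

Lemma seminorm0 p : continuous_seminorm p -> p 0 = 0.
Proof. by move=> [_ pZ _]; rewrite -(scale0r 0) pZ normr0 mul0r. Qed.

Lemma seminormN p x : continuous_seminorm p -> p (- x) = p x.
Proof. by move=> [_ pZ _]; rewrite -scaleN1r pZ normrN1 mul1r. Qed.

Lemma seminorm_ge0 p x : continuous_seminorm p -> 0 <= p x.
Proof.
move=> cp; have [pD _ _] := cp.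
by have := pD x (- x); rewrite subrr seminorm0// seminormN//; lra.
Qed.

Lemma seminormZ p (a : R) x : continuous_seminorm p -> p (a *: x) = `|a| * p x.
Proof. by case. Qed.

Lemma seminormD p x y : continuous_seminorm p -> p (x + y) <= p x + p y.
Proof. by case. Qed.

Lemma seminorm_nbhs p x e : continuous_seminorm p -> 0 < e ->
  \forall y \near x, p (y - x) < e.
Proof.
move=> cp e0.
have : (fun y => p (y - x)) @ x --> p (x - x).
  apply: (@cvg_comp _ _ _ (fun y => y - x) p _ (nbhs (x - x))).
    by apply: tvs_cvgB; [exact: cvg_id|exact: cvg_cst].
  by case: cp => _ _; apply.
rewrite subrr seminorm0// => /cvgr_lt; exact.
Qed.

(** Local convexity turned into seminorms: [p] is the Minkowski gauge of a
    symmetric convex neighbourhood of [0] contained in [U]. *)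
Lemma nbhs_seminorm (U : set E) : nbhs 0 U ->
  exists2 p, continuous_seminorm p & forall x, p x < 1 -> U x.
Proof.
move=> U0.
have [BB Bconv [Bo Bb]] := @locally_convex R E.
have [B1 [BB1 B10] B1U] := Bb 0 U U0.
pose B : set E := fun x => B1 x /\ B1 (- x).
have B0 : nbhs 0 B.
  have B1n : nbhs 0 B1 by apply: open_nbhs_nbhs; split => //; exact: Bo.
  apply: filterI => //; apply: (@opp_continuous E 0 B1).
  by rewrite oppr0.
have conv1 (x y : E) t : 0 <= t <= 1 -> B1 x -> B1 y -> B1 (t *: x + (1 - t) *: y).
  move=> t01 Bx By.
  pose l : {i01 R} := Itv01 (andP t01).1 (andP t01).2.
  have := Bconv B1 (mem_set BB1) x y l (mem_set Bx) (mem_set By).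
  by move=> /set_mem.
have conv (x y : E) t : 0 <= t <= 1 -> B x -> B y -> B (t *: x + (1 - t) *: y).
  move=> t01 [Bx Bx'] [By By']; split; first exact: conv1.
  by rewrite opprD -!scalerN; exact: conv1.
have BN x : B x -> B (- x) by move=> [? ?]; split; rewrite ?opprK.
have B00 : B 0 by exact: nbhs_singleton.
have star x a : `|a| <= 1 -> B x -> B (a *: x).
  wlog a0 : x a / 0 <= a => [H|] a1 Bx.
    have [a0|/ltW a0] := leP 0 a; first exact: H.
    rewrite -[a]opprK scaleNr; apply/BN/H => //; first by rewrite oppr_ge0.
    by rewrite normrN.
  rewrite -[_ *: _]addr0 -(scaler0 E (1 - a)); apply: conv => //.
  by rewrite a0 -(ger0_norm a0).
(* [p x < r] implies [x \in r *: B], which implies [p x <= r] *)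
pose S x : set R := [set r | 0 < r /\ B (r^-1 *: x)].
have S_up x r s : r <= s -> S x r -> S x s.
  move=> rs [r0 Br]; have s0 := lt_le_trans r0 rs; split => //.
  have -> : s^-1 *: x = (r / s) *: (r^-1 *: x).
    by rewrite scalerA mulrAC divff ?gt_eqF// mul1r.
  by apply: star => //; rewrite ger0_norm ?ler_pdivrMr ?mul1r// divr_ge0// ltW.
have S_ne x : S x !=set0.
  have : (fun a : R => a *: x) @ (0 : R) --> (0 : R) *: x.
    by apply: tvs_cvgZ; [exact: cvg_id|exact: cvg_cst].
  rewrite scale0r => /(_ _ B0)/nbhs_ballP[e/= e0 eB].
  exists (e / 2)^-1; split; first by rewrite invr_gt0 divr_gt0.
  rewrite invrK; apply: eB; rewrite /ball/= sub0r normrN ger0_norm; last lra.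
  lra.
have S_lb x : has_lbound (S x) by exists 0 => r [/ltW].
pose p x := inf (S x).
have p_lt x r : p x < r -> S x r.
  move=> /(inf_lt (S_ne x))[s Ss sr].
  exact: S_up (ltW sr) Ss.
have p_le x r : S x r -> p x <= r by move=> Sr; exact: ge_inf.
have p_ge0 x : 0 <= p x by apply: (lb_le_inf (S_ne x)) => r [/ltW].
have pD x y : p (x + y) <= p x + p y.
  apply/ler_addgt0Pl => e e0.
  have [r0 Br] : S x (p x + e / 2) by apply: p_lt; lra.
  have [s0 Bs] : S y (p y + e / 2) by apply: p_lt; lra.
  rewrite (_ : e + _ = (p x + e / 2) + (p y + e / 2)); last lra.
  move: (p x + e / 2) (p y + e / 2) => r s in r0 Br s0 Bs *.
  apply: p_le; split; first lra.
  have -> : (r + s)^-1 *: (x + y) =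
      (r / (r + s)) *: (r^-1 *: x) + (1 - r / (r + s)) *: (s^-1 *: y).
    have rs : r + s != 0 by lra.
    rewrite !scalerA scalerDr; congr (_ *: _ + _ *: _).
      by rewrite mulrAC divff ?gt_eqF// mul1r.
    rewrite -[X in X - _](divff rs) -mulrBl addrAC subrr add0r mulrAC divff ?gt_eqF//.
    by rewrite mul1r.
  apply: conv => //; rewrite divr_ge0/=; try lra.
  rewrite ler_pdivrMr; lra.
have pZle a x : p (a *: x) <= `|a| * p x.
  have [->|a0] := eqVneq a 0.
    rewrite scale0r normr0 mul0r.
    apply/ler_addgt0Pl => e e0; rewrite addr0; apply: p_le; split => //.
    by rewrite scaler0.
  have na0 : 0 < `|a| by rewrite normr_gt0.
  rewrite -ler_pdivrMl//; apply/ler_addgt0Pl => e e0; rewrite ler_pdivrMl//.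
  have [r0 Br] : S x (p x + e) by apply: p_lt; lra.
  rewrite [e + _]addrC; move: (p x + e) => r in r0 Br *.
  apply: p_le; split; first by rewrite mulr_gt0.
  have -> : (`|a| * r)^-1 *: (a *: x) = (a / `|a|) *: (r^-1 *: x).
    by rewrite !scalerA invfM; congr (_ *: _); ring.
  by apply: star => //; rewrite normrM normfV normr_id divff// gt_eqF.
exists p; last first.
  by move=> x /p_lt[_]; rewrite invr1 scale1r => -[Bx _]; exact: B1U.
split => //.
  move=> a x; apply/eqP; rewrite eq_le pZle/=.
  have [->|a0] := eqVneq a 0; first by rewrite normr0 mul0r.
  have := pZle a^-1 (a *: x); rewrite scalerA mulVf// scale1r normfV.
  by rewrite ler_pdivlMl// normr_gt0.
have p_near e : 0 < e -> \forall z \near (0 : E), p z < e.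
  move=> e0; have e20 : 0 < e / 2 by lra.
  have : nbhs 0 ( *:%R (e / 2) @` B) by apply: nbhs0Z => //; rewrite gt_eqF.
  apply: filterS => _ [z Bz <-]; apply: (@le_lt_trans _ _ (e / 2)); last lra.
  apply: p_le; split => //; rewrite scalerA mulVf ?scale1r//; lra.
move=> x; apply/cvgrPdist_lt => e e0.
have sub : (fun y => y - x) @ x --> (x - x : E).
  by apply: tvs_cvgB; [exact: cvg_id|exact: cvg_cst].
rewrite subrr in sub.
have : \forall y \near x, p (y - x) < e := sub _ (p_near e e0).
apply: filterS => y pe.
have h1 := pD (y - x) x; have h2 := pD (x - y) y.
have h3 : p (x - y) <= p (y - x).
  by rewrite -opprB -scaleN1r (le_trans (pZle _ _))// normrN1 mul1r.
rewrite !subrK in h1 h2; rewrite ltr_distl; apply/andP; split; lra.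
Qed.

Lemma tvs_nbhsP (x : E) (U : set E) : nbhs x U ->
  exists2 p, continuous_seminorm p & forall y, p (y - x) < 1 -> U y.
Proof.
move=> Ux; have [|p cp pU] := @nbhs_seminorm (fun z => U (z + x)).
  have : (fun z => z + x) @ (0 : E) --> 0 + x.
    by apply: tvs_cvgD; [exact: cvg_id|exact: cvg_cst].
  by rewrite add0r; apply.
by exists p => // y /pU; rewrite subrK.
Qed.

Lemma tvs_cvgP {T : Type} {F : set_system T} {FF : Filter F} (f : T -> E) l :
  f @ F --> l <-> forall p e, continuous_seminorm p -> 0 < e ->
    \forall t \near F, p (f t - l) < e.
Proof.
split=> [fl p e cp e0|H U Ul]; first exact: (fl _ (seminorm_nbhs l cp e0)).
have [p cp pU] := tvs_nbhsP Ul.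
by apply: filterS (H p 1 cp ltr01) => t; exact: pU.
Qed.

End SeminormTheory.

(** * Calculus in locally convex spaces *)

(** A compactness principle for [[a, b]]: a property of intervals that is stable
    under concatenation and holds for all short intervals with a given end point
    holds for [[a, b]], since the supremum of the [t] with [P a t] can be neither
    missed nor less than [b]. *)
Lemma interval_chain {R : realType} (P : R -> R -> Prop) (a b : R) : a <= b ->
  (forall s t u, s <= t <= u -> P s t -> P t u -> P s u) ->
  (forall t, a <= t <= b -> \forall h \near (0 : R), a <= t + h <= b ->
    (0 <= h -> P t (t + h)) /\ (h <= 0 -> P (t + h) t)) ->
  P a b.
Proof.
move=> ab Ptrans Ploc.
pose S : set R := [set t | a <= t <= b /\ P a t].
have Sa : S a.
  split; first by rewrite lexx.
  have /Ploc/nbhs_singleton : a <= a <= b by rewrite lexx.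
  by rewrite addr0 lexx ab => /(_ isT)[/(_ (lexx _))].
have Sb : ubound S b by move=> t [/andP[]].
have supS : has_sup S by split; [exists a|exists b].
pose s := sup S.
have as_ : a <= s by apply: sup_upper_bound.
have sb : s <= b by apply: sup_le_ub => //; exists a.
have /Ploc/nbhs_ballP[e/= e0 eP] : a <= s <= b by rewrite as_.
have Pas : P a s.
  have [t [/andP[at_ tb] Pat] st] := sup_adherent e0 supS.
  have ts : t <= s by apply: sup_upper_bound => //; split=> //; rewrite at_.
  have := eP (t - s); rewrite /ball/= sub0r normrN ler0_norm; last lra.
  rewrite -/s in st; rewrite [s + _]addrC subrK at_ tb.
  case; [lra|by []|move=> _ Pts].
  by apply: (Ptrans a t s) => //; [rewrite at_|apply: Pts; lra].
suff -> : b = s by [].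
apply/eqP; rewrite eq_le sb andbT leNgt; apply/negP => sltb.
pose h := Num.min (e / 2) (b - s).
have h0 : 0 < h by rewrite /h lt_min; apply/andP; split; lra.
have he : h <= e / 2 by rewrite ge_min lexx.
have hb : h <= b - s by rewrite ge_min lexx orbT.
have : S (s + h).
  split; first by apply/andP; split; lra.
  apply: (Ptrans a s); [apply/andP; split; lra|by []|].
  apply: (proj1 (eP h _ _)); last exact: ltW.
    by rewrite /ball/= sub0r normrN ger0_norm; lra.
  by apply/andP; split; lra.
by move=> /(sup_upper_bound supS); rewrite -/s; lra.
Qed.

Section DirectionalDerivative.
Context {R : realType} {E F : tvsType R}.
Implicit Types (f : E -> F).

Lemma has_dderive_dderive f x v :
  (exists l, has_dderive f x v l) -> has_dderive f x v (dderive f x v).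
Proof. by move=> /(xgetPex 0). Qed.

Lemma dderiveE f x v l : hausdorff_space F ->
  has_dderive f x v l -> dderive f x v = l.
Proof.
move=> hF fl; apply: (cvg_unique hF _ fl).
by apply: has_dderive_dderive; exists l.
Qed.

Lemma has_dderiveZ f x v l (a : R) : a != 0 ->
  has_dderive f x v l -> has_dderive f x (a *: v) (a *: l).
Proof.
move=> a0 fl; rewrite /has_dderive.
have -> : (fun h => h^-1 *: (f (x + h *: (a *: v)) - f x)) =
    (fun h => a *: ((h * a)^-1 *: (f (x + (h * a) *: v) - f x))).
  apply/funext => h; rewrite !scalerA; congr (_ *: (f (_ + _) - _)).
  by rewrite invfM mulrCA divff// mulr1.
apply: tvs_cvgZ; first exact: cvg_cst.
apply: (@cvg_comp _ _ _ (fun h => h * a) (fun k => k^-1 *: (f (x + k *: v) - f x))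
  _ ((0 : R)^')) => //.
move=> U; rewrite /dnbhs/= => U0.
have ca : (fun h : R => h * a) @ (0 : R) --> (0 : R) * a.
  by apply: cvgM; [exact: cvg_id|exact: cvg_cst].
rewrite mul0r in ca.
have : \forall h \near (0 : R), h * a != 0 -> U (h * a) := ca _ U0.
by apply: filterS => h Uh h0; apply: Uh; rewrite mulf_neq0.
Qed.

(** The mean value inequality for [s |-> f (x + s *: v) - s *: L]: increments over
    short intervals are estimated by the derivative, up to any [e > 0], and these
    estimates add up along [[0, 1]]. *)
Lemma dderive_mean_value (p : F -> R) f x v (L : F) K : continuous_seminorm p ->
  (forall s, 0 <= s <= 1 ->
    exists2 l, has_dderive f (x + s *: v) v l & p (l - L) <= K) ->
  p (f (x + v) - f x - L) <= K.
Proof.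
move=> cp H; apply/ler_addgt0Pr => e e0.
pose g (s : R) := f (x + s *: v) - s *: L.
pose P s t : Prop := p (g t - g s) <= (K + e) * (t - s).
suff : P 0 1.
  by rewrite /P /g !scale1r !scale0r addr0 !subr0 mulr1 addrAC.
apply: interval_chain => //.
  move=> s t u _; rewrite /P => Pst Ptu.
  rewrite -[g u - g s](subrKA (g t)).
  by apply: (le_trans (seminormD _ _ cp)); lra.
move=> s /H[l fl lK].
have : \forall h \near (0 : R), h != 0 ->
    p (h^-1 *: (f (x + s *: v + h *: v) - f (x + s *: v)) - l) < e.
  exact: (tvs_cvgP _ _).1 fl p e cp e0.
apply: filterS => h he _.
suff PP : p (g (s + h) - g s) <= (K + e) * `|h|.
  rewrite /P; split => h0.
    by have -> : s + h - s = h; [lra|rewrite ger0_norm in PP].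
  rewrite -opprB seminormN// [X in _ * X](_ : _ = - h); last lra.
  by rewrite -(ler0_norm h0).
have [->|h0] := eqVneq h 0; first by rewrite addr0 subrr seminorm0// normr0 mulr0.
have -> : g (s + h) - g s =
   h *: (h^-1 *: (f (x + s *: v + h *: v) - f (x + s *: v)) - l + (l - L)).
  rewrite addrA subrK scalerBr scalerA divff// scale1r /g !scalerDl -addrA.
  rewrite opprD opprB [- (s *: L) + _]addrC !addrA subrK.
  by rewrite addrAC.
rewrite seminormZ// mulrC ler_wpM2r//.
apply: (le_trans (seminormD _ _ cp)); rewrite addrC lerD//.
exact/ltW/he/h0.
Qed.

(** The case [k = 1] of the continuity of iterated derivatives, with the space of
    one-element families of directions identified with [E]. *)
Lemma smooth_on_dderive_continuous f U x0 w0 : smooth_on U f -> U x0 ->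
  (fun p : E * E => dderive f p.1 p.2) @ (x0, w0) --> dderive f x0 w0.
Proof.
move=> [_ /(_ 1 x0 (fun=> w0))] H /H{}H.
pose j (w : E) : {ptws 'I_1 -> E} := fun=> w.
have jc : j @ w0 --> j w0.
  apply/cvg_sup => i A [_ [[B Bo <-] Bw] BA].
  by apply: (filterS (P := B)) => [w Bw'|]; [exact: (BA (j w))|exact: open_nbhs_nbhs].
have eqd (p : E * {ptws 'I_1 -> E}) :
    iter_dderive f [seq p.2 i | i <- enum 'I_1] p.1 = dderive f p.1 (p.2 ord0).
  by rewrite enum_ordSl (_ : enum 'I_0 = [::])//; apply/size0nil; rewrite size_enum_ord.
have c1 : (fun p : E * E => p.1) @ (x0, w0) --> x0 by exact: cvg_fst.
have c2 : (fun p : E * E => j p.2) @ (x0, w0) --> j w0.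
  by apply: (cvg_comp _ _ cvg_snd).
have -> : (fun p : E * E => dderive f p.1 p.2) =
    (fun p => iter_dderive f [seq (j p.2) i | i <- enum 'I_1] p.1).
  by apply/funext => p; rewrite (eqd (p.1, j p.2)).
have := @cvg_comp2 _ _ _ _ (nbhs (x0, w0)) (nbhs x0) (nbhs (j w0)) _ _ _ _ _ _
  (fun x y => iter_dderive f [seq y i | i <- enum 'I_1] x) c1 c2 H.
by rewrite (eqd (x0, fun=> w0)); apply.
Qed.

(** Strict differentiability. The point and the direction may vary along with
    the step, because by the mean value inequality the error of the quotient is
    that of [dderive f] on the short segment from [x t] to [x t + h t *: w t],
    where [dderive f] is jointly continuous. The first order rules for products
    in a group below all rest on this freedom. *)
Lemma smooth_on_cvg_quotient f U x0 w0 (T : Type) (Fl : set_system T)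
    (h : T -> R) (x w : T -> E) : Filter Fl -> smooth_on U f -> nbhs x0 U ->
  h @ Fl --> 0 -> (\forall t \near Fl, h t != 0) ->
  x @ Fl --> x0 -> w @ Fl --> w0 ->
  (fun t => (h t)^-1 *: (f (x t + h t *: w t) - f (x t))) @ Fl --> dderive f x0 w0.
Proof.
move=> FF sf U0 h0 hn0 xx0 ww0; apply/tvs_cvgP => p e cp e0.
have dc := @smooth_on_dderive_continuous f U x0 w0 sf (nbhs_singleton U0).
have /tvs_cvgP/(_ p (e / 2) cp) := dc; case; first lra.
move=> [A B] /= [A0 B0] AB.
have [q cq qA] := tvs_nbhsP (filterI A0 U0).
have hw : (fun t => h t *: w t) @ Fl --> 0.
  by rewrite -(scale0r w0); exact: tvs_cvgZ.
have e20 : 0 < e / 2 by lra.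
have q12 : (0 : R) < 2^-1 by lra.
have H1 : \forall t \near Fl, q (x t - x0) < 2^-1.
  exact: (tvs_cvgP _ _).1 xx0 q _ cq q12.
have H2 : \forall t \near Fl, q (h t *: w t - 0) < 2^-1.
  exact: (tvs_cvgP _ _).1 hw q _ cq q12.
have H3 : \forall t \near Fl, B (w t) := ww0 _ B0.
near=> t.
have ht0 : h t != 0 by near: t.
suff : p (f (x t + h t *: w t) - f (x t) - h t *: dderive f x0 w0) <= `|h t| * (e / 2).
  rewrite -ler_pdivrMl ?normr_gt0// -normfV -seminormZ// scalerBr scalerA mulVf//.
  by rewrite scale1r => /le_lt_trans; apply; lra.
apply: (@dderive_mean_value p f) => // s /andP[s0 s1].
have qs : q (x t + s *: (h t *: w t) - x0) < 1.
  rewrite addrAC; apply: (le_lt_trans (seminormD _ _ cq)).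
  rewrite seminormZ// ger0_norm//.
  have k1 : q (x t - x0) < 2^-1 by near: t.
  have k2 : q (h t *: w t - 0) < 2^-1 by near: t.
  rewrite subr0 in k2.
  have := ler_wpM2r (seminorm_ge0 (h t *: w t) cq) s1; lra.
have [As Us] := qA _ qs.
exists (h t *: dderive f (x t + s *: (h t *: w t)) (w t)).
  by apply: has_dderiveZ => //; apply: has_dderive_dderive; exact: sf.1 [::] _ _ Us.
rewrite -scalerBr seminormZ// ler_wpM2l//; apply/ltW.
by apply: (AB (_, _)); split => //=; near: t.
Unshelve. all: by end_near. Qed.

End DirectionalDerivative.

(** * Translation of charts *)

Section Translation.
Context {R : realType} {E F : tvsType R}.
Implicit Types (f : E -> F) (U : set E).

Lemma has_dderive_addr f x0 x v l :
  has_dderive (fun x => f (x + x0)) x v l = has_dderive f (x + x0) v l.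
Proof.
rewrite /has_dderive (_ : (fun h : R => _) =
  (fun h => h^-1 *: (f (x + x0 + h *: v) - f (x + x0))))//.
by apply/funext => h; rewrite addrAC.
Qed.

Lemma has_dderive_subr f y0 x v l :
  has_dderive (fun x => f x - y0) x v l = has_dderive f x v l.
Proof.
rewrite /has_dderive (_ : (fun h : R => _) =
  (fun h => h^-1 *: (f (x + h *: v) - f x)))//.
by apply/funext => h; rewrite opprB addrA subrK.
Qed.

Lemma dderive_addr f x0 (v : E) :
  dderive (fun x => f (x + x0)) ^~ v = (fun x => dderive f (x + x0) v).
Proof.
by apply/funext => x; congr xget; apply/funext => l; exact: has_dderive_addr.
Qed.

Lemma dderive_subr f y0 (v : E) : dderive (fun x => f x - y0) ^~ v = dderive f ^~ v.
Proof.
by apply/funext => x; congr xget; apply/funext => l; exact: has_dderive_subr.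
Qed.

Lemma iter_dderive_addr f x0 (vs : seq E) :
  iter_dderive (fun x => f (x + x0)) vs = (fun x => iter_dderive f vs (x + x0)).
Proof.
elim: vs f => //= v vs IH f; rewrite /iter_dderive/= dderive_addr.
exact: (IH (dderive f ^~ v)).
Qed.

Lemma iter_dderive_subr f y0 (vs : seq E) : vs != [::] ->
  iter_dderive (fun x => f x - y0) vs = iter_dderive f vs.
Proof. by case: vs => // v vs _; rewrite /iter_dderive/= dderive_subr. Qed.

Lemma smooth_on_addr f U x0 : smooth_on U f ->
  smooth_on [set x | U (x + x0)] (fun x => f (x + x0)).
Proof.
move=> [sf cf]; split=> [vs v x Ux|k x w Ux].
  have [l fl] := sf vs v _ Ux; exists l.
  by rewrite iter_dderive_addr has_dderive_addr.
rewrite (_ : (fun p : E * {ptws 'I_k -> E} => _) = (fun p =>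
   iter_dderive f [seq p.2 i | i <- enum 'I_k] (p.1 + x0))); last first.
  by apply/funext => p; rewrite iter_dderive_addr.
have c1 : (fun p : E * {ptws 'I_k -> E} => p.1 + x0) @ (x, w) --> x + x0.
  by apply: tvs_cvgD; [exact: cvg_fst|exact: cvg_cst].
have c2 : (fun p : E * {ptws 'I_k -> E} => p.2) @ (x, w) --> w by exact: cvg_snd.
exact: (@cvg_comp2 _ _ _ _ (nbhs (x, w)) (nbhs (x + x0)) (nbhs w) _ _ _ _ _ _
  (fun x y => iter_dderive f [seq y i | i <- enum 'I_k] x) c1 c2 (cf k _ w Ux)).
Qed.

Lemma smooth_on_subr f U y0 : smooth_on U f -> smooth_on U (fun x => f x - y0).
Proof.
move=> [sf cf]; split=> [vs v x Ux|k x w Ux].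
  have [l fl] := sf vs v _ Ux; exists l; move: fl.
  have [->|vs0] := eqVneq vs [::]; last by rewrite iter_dderive_subr.
  by rewrite /= has_dderive_subr.
have := cf k x w Ux; case: k w => [|k] w cfk; last first.
  rewrite (_ : (fun p : E * {ptws 'I_k.+1 -> E} => _) = (fun p =>
    iter_dderive f [seq p.2 i | i <- enum 'I_k.+1] p.1))//.
  by apply/funext => p; rewrite iter_dderive_subr// enum_ordSl.
have e0 (w' : {ptws 'I_0 -> E}) : [seq w' i | i <- enum 'I_0] = [::].
  by apply/size0nil; rewrite size_map size_enum_ord.
rewrite (_ : (fun p : E * {ptws 'I_0 -> E} => _) = (fun p =>
  iter_dderive f [seq p.2 i | i <- enum 'I_0] p.1 - y0)); last first.
  by apply/funext => p; rewrite !e0.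
by apply: tvs_cvgB => //; exact: cvg_cst.
Qed.

End Translation.

Section TranslatedChart.
Context {R : realType} {M : topologicalType} {E : tvsType R}.
Variables (c : chart M E) (x0 : E).

Let addr_cvg x : (fun y => y + x0) @ x --> x + x0.
Proof. by apply: tvs_cvgD; [exact: cvg_id|exact: cvg_cst]. Qed.

Let cod := [set x | ccod c (x + x0)].
Let map p := cmap c p - x0.
Let inv x := cinv c (x + x0).

Let cod_open : open cod.
Proof.
rewrite openE => x cx; apply: addr_cvg.
by apply: open_nbhs_nbhs; split=> //; exact: ccod_open.
Qed.

Let map_cod p : cdom c p -> cod (map p).
Proof. by rewrite /cod/map/= subrK; exact: cmap_ccod. Qed.

Let inv_dom x : cod x -> cdom c (inv x).
Proof. exact: cinv_cdom. Qed.

Let mapK p : cdom c p -> inv (map p) = p.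
Proof. by rewrite /inv/map subrK; exact: cmapK. Qed.

Let invK x : cod x -> map (inv x) = x.
Proof. by rewrite /inv/map => /cinvK ->; rewrite addrK. Qed.

Let map_continuous p : cdom c p -> {for p, continuous map}.
Proof.
by move=> cp; exact: tvs_cvgB (cmap_continuous cp) (cvg_cst _).
Qed.

Let inv_continuous x : cod x -> {for x, continuous inv}.
Proof. by move=> cx; exact: (cvg_comp _ _ (@addr_cvg x) (cinv_continuous cx)). Qed.

(** Local mu-convexity only speaks of charts that send [1] to [0]. *)
Definition translated_chart : chart M E :=
  Chart (@cdom_open _ _ _ c) cod_open map_cod inv_dom mapK invK
        map_continuous inv_continuous.

Lemma compatible_translated_chart d : compatible c d -> compatible translated_chart d.
Proof.
move=> [cd dc].
by split; [exact: (smooth_on_addr x0 cd)|exact: (smooth_on_subr x0 dc)].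
Qed.

End TranslatedChart.

(** * First order calculus in a Lie group *)

Lemma chart_domain_nbhs {R : realType} {M : topologicalType} {E : tvsType R}
  (c : chart M E) p : cdom c p -> nbhs p (cdom c).
Proof. by move=> cp; apply: open_nbhs_nbhs; split=> //; exact: cdom_open. Qed.

Section SmoothMaps.
Context {R : realType} {M N : topologicalType} {E F : tvsType R}.

Lemma chart_image_nbhs (c : chart M E) (d : chart N F) (f : M -> N) p :
  continuous f -> cdom c p -> cdom d (f p) ->
  nbhs (cmap c p) [set x | ccod c x /\ cdom d (f (cinv c x))].
Proof.
move=> cf cp dfp; apply: filterI.
  by apply: open_nbhs_nbhs; split; [exact: ccod_open|exact: cmap_ccod].
have cc : cinv c @ cmap c p --> p.
  by rewrite -[X in _ --> X](cmapK cp); exact/cinv_continuous/cmap_ccod.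
have fcc : (fun x => f (cinv c x)) @ cmap c p --> f p := cvg_comp _ _ cc (cf p).
exact: (fcc _ (chart_domain_nbhs dfp)).
Qed.

(** [smooth_on_cvg_quotient] read in charts: the points [p t] and [p' t] both
    move, and only their difference in the chart is of first order. *)
Lemma smooth_map_cvg_quotient A B (f : M -> N) (c : chart M E) (d : chart N F)
    (T : Type) (Fl : set_system T) (h : T -> R) (p p' : T -> M) p0 v :
  Filter Fl -> smooth_map A B f -> A c -> B d -> cdom c p0 -> cdom d (f p0) ->
  h @ Fl --> 0 -> (\forall t \near Fl, h t != 0) ->
  p @ Fl --> p0 -> p' @ Fl --> p0 ->
  (fun t => (h t)^-1 *: (cmap c (p' t) - cmap c (p t))) @ Fl --> v ->
  (fun t => (h t)^-1 *: (cmap d (f (p' t)) - cmap d (f (p t)))) @ Fl -->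
    dderive (fun x => cmap d (f (cinv c x))) (cmap c p0) v.
Proof.
move=> FF [cf sf] Ac Bd cp0 dfp0 h0 hn0 pp0 p'p0 qv.
have U0 := chart_image_nbhs cf cp0 dfp0.
have cpx : (fun t => cmap c (p t)) @ Fl --> cmap c p0.
  exact: (cvg_comp _ _ pp0 (cmap_continuous cp0)).
have := smooth_on_cvg_quotient FF (sf c d Ac Bd) U0 h0 hn0 cpx qv.
apply: cvg_trans; apply: near_eq_cvg; near=> t.
have ht : h t != 0 by near: t.
have pt : cdom c (p t) by near: t; exact: pp0 _ (chart_domain_nbhs cp0).
have p't : cdom c (p' t) by near: t; exact: p'p0 _ (chart_domain_nbhs cp0).
by rewrite scalerA divff// scale1r [cmap c (p t) + _]addrC subrK !cmapK.
Unshelve. all: by end_near. Qed.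

Lemma dderive0 (f : E -> F) x : hausdorff_space F -> dderive f x 0 = 0.
Proof.
move=> hF; apply: dderiveE => //; rewrite /has_dderive.
by apply: eq_cvg_to (cvg_cst 0) => h; rewrite scaler0 addr0 subrr scaler0.
Qed.

End SmoothMaps.

Section Infinitesimal.
Context {R : realType} {E : tvsType R} {G : lieGroupType E}.
Hypothesis hE : hausdorff_space E.

Let c1 : chart G E := chart_at (1%g : G).

Lemma cvg_mulg (T : Type) (Fl : set_system T) (FF : Filter Fl) (f g : T -> G) a b :
  f @ Fl --> a -> g @ Fl --> b -> (fun t => f t * g t)%g @ Fl --> (a * b)%g.
Proof.
move=> fa gb; apply: (cvg_comp2 fa gb).
exact: (proj1 (@mulg_smooth R E G) (a, b)).
Qed.

Lemma cvg_invg (T : Type) (Fl : set_system T) (FF : Filter Fl) (f : T -> G) a :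
  f @ Fl --> a -> (fun t => (f t)^-1)%g @ Fl --> a^-1%g.
Proof.
by move=> fa; exact: (cvg_comp _ _ fa (proj1 (@invg_smooth R E G) a)).
Qed.

(** The differential of the multiplication at [(g, k)] in the charts [c], [d] at
    the factors and [e] at the product. It is only evaluated on pairs with a zero
    entry: the rules below vary one factor at a time. *)
Definition mul_dderive (c d e : chart G E) (g k : G) (v w : E) : E :=
  dderive (fun x : E * E => cmap e (cinv c x.1 * cinv d x.2)%g)
    (cmap c g, cmap d k) (v, w).

Lemma mul_cvg_quotient (c d e : chart G E)
    (T : Type) (Fl : set_system T) (h : T -> R) (g g' k k' : T -> G) g0 k0 v w :
  Filter Fl -> atlas c -> atlas d -> atlas e ->
  cdom c g0 -> cdom d k0 -> cdom e (g0 * k0)%g ->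
  h @ Fl --> 0 -> (\forall t \near Fl, h t != 0) ->
  g @ Fl --> g0 -> g' @ Fl --> g0 -> k @ Fl --> k0 -> k' @ Fl --> k0 ->
  (fun t => (h t)^-1 *: (cmap c (g' t) - cmap c (g t))) @ Fl --> v ->
  (fun t => (h t)^-1 *: (cmap d (k' t) - cmap d (k t))) @ Fl --> w ->
  (fun t => (h t)^-1 *: (cmap e (g' t * k' t)%g - cmap e (g t * k t)%g)) @ Fl -->
    mul_dderive c d e g0 k0 v w.
Proof.
move=> FF Ac Ad Ae cg0 dk0 egk0 h0 hn0 gg0 g'g0 kk0 k'k0 qv qw.
have pA : prod_atlas atlas atlas (prod_chart c d) by exists c => //; exists d.
have := @smooth_map_cvg_quotient _ _ _ _ _ _ _ _ (prod_chart c d) e _ Fl h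
  (fun t => (g t, k t)) (fun t => (g' t, k' t)) (g0, k0) (v, w) FF
  (@mulg_smooth R E G) pA Ae (conj cg0 dk0) egk0 h0 hn0.
apply; [exact: cvg_pair|exact: cvg_pair|].
exact: (cvg_pair qv qw).
Qed.

Lemma mul_dderive0 c d e g k : mul_dderive c d e g k 0 0 = 0.
Proof. exact: dderive0. Qed.

Lemma mul_dderive_1r w : mul_dderive c1 c1 c1 1%g 1%g 0 w = w.
Proof.
apply: dderiveE => //; rewrite /has_dderive/=.
have c11 : cdom c1 1%g := mem_chart_at 1%g.
have cx : (fun h : R => cmap c1 1%g + h *: w) @ (0 : R)^' --> cmap c1 1%g.
  rewrite -[X in _ --> X]addr0; apply: tvs_cvgD; first exact: cvg_cst.
  rewrite -(scale0r w); apply: tvs_cvgZ; last exact: cvg_cst.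
  exact: cvg_within.
apply: cvg_trans (cvg_cst w).
apply: near_eq_cvg; near=> h.
have ch : ccod c1 (cmap c1 1%g + h *: w).
  near: h; apply: cx; apply: open_nbhs_nbhs; split; first exact: ccod_open.
  exact: cmap_ccod.
rewrite /= scaler0 addr0 cmapK// !mul1g cinvK// addrC addKr scalerA mulVf ?scale1r//.
by near: h; rewrite near_withinE; exact: nearW.
Unshelve. all: first [exact: dnbhs_filter | by end_near]. Qed.

(** [infinitesimal Fl h a v]: to first order in the step [h] along [Fl], the
    group elements [a t] are the points [h t *: v] of the Lie algebra. The first
    conjunct matters because [cmap] is arbitrary outside of its chart. *)
Definition infinitesimal (T : Type) (Fl : set_system T) (h : T -> R) (a : T -> G) (v : E) :=
  a @ Fl --> (1%g : G) /\
  (fun t => (h t)^-1 *: (cmap c1 (a t) - cmap c1 1%g)) @ Fl --> v.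

Lemma cvg_quotient_cst (T : Type) (Fl : set_system T) (FF : Filter Fl) (h : T -> R)
    (c : chart G E) (g : T -> G) :
  (fun t => (h t)^-1 *: (cmap c (g t) - cmap c (g t))) @ Fl --> (0 : E).
Proof. by apply: eq_cvg_to (cvg_cst 0) => t; rewrite subrr scaler0. Qed.

Lemma infinitesimal_sub (T : Type) (F F' : set_system T) (h : T -> R) (a : T -> G) (X : E) :
  F' `=>` F -> infinitesimal F h a X -> infinitesimal F' h a X.
Proof. by move=> FF' [a1 aX]; split=> U HU; apply: FF'; [exact: a1|exact: aX]. Qed.

Lemma infinitesimal_ext (T : Type) (F : set_system T) (h : T -> R) (a a' : T -> G) (X : E) :
  a =1 a' -> infinitesimal F h a X -> infinitesimal F h a' X.
Proof. by move=> /funext ->. Qed.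

Lemma infinitesimal_comp (S T : Type) (F : set_system S) (F' : set_system T)
    (phi : S -> T) (h : T -> R) (a : T -> G) (X : E) :
  phi @ F --> F' -> infinitesimal F' h a X ->
  infinitesimal F (h \o phi) (a \o phi) X.
Proof.
by move=> pF [a1 aX]; split; [exact: (cvg_comp _ _ pF a1)|exact: (cvg_comp _ _ pF aX)].
Qed.

Lemma infinitesimal_near (T : Type) (F : set_system T) (h : T -> R) (a a' : T -> G) (X : E) :
  Filter F -> (\forall t \near F, a t = a' t) ->
  infinitesimal F h a X -> infinitesimal F h a' X.
Proof.
move=> FF aa' [a1 aX]; split.
  apply: cvg_trans a1; apply: near_eq_cvg.
  by apply: filterS aa' => t ->.
apply: cvg_trans aX; apply: near_eq_cvg.
by apply: filterS aa' => t ->.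
Qed.

Section Filtered.
Context (T : Type) (Fl : set_system T) (FF : Filter Fl) (h : T -> R).
Hypotheses (h0 : h @ Fl --> 0) (hn0 : \forall t \near Fl, h t != 0).
Implicit Types a b : T -> G.

Let c11 : cdom c1 1%g := mem_chart_at 1%g.

(** The increment from [1] to [a * b] is the one from [1] to [a], followed by the
    one from [a] to [a * b]; the latter is that of [b] since [a] tends to [1]. *)
Lemma infinitesimal_mul a b v w : infinitesimal Fl h a v ->
  infinitesimal Fl h b w -> infinitesimal Fl h (fun t => a t * b t)%g (v + w).
Proof.
move=> [a1 av] [b1 bw]; split; first by rewrite -(mulg1 1%g); exact: cvg_mulg.
have c111 : cdom c1 (1 * 1)%g by rewrite mulg1.
have := mul_cvg_quotient FF (atlas_chart_at 1%g) (atlas_chart_at 1%g)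
  (atlas_chart_at 1%g) c11 c11 c111 h0 hn0 a1 a1 (cvg_cst 1%g) b1
  (cvg_quotient_cst FF h c1 a) bw.
rewrite mul_dderive_1r => /(_ FF) abw; rewrite addrC.
apply: eq_cvg_to (tvs_cvgD abw av) => t.
by rewrite -scalerDr mulg1 addrA subrK.
Qed.

(** The elements [g t] are allowed to move, which gives uniform estimates over
    compact sets. In the charts around [g0] and its inverse, the two products
    depend on [a t] through differentials applied to zero. *)
Lemma infinitesimal_conj0 (g : T -> G) (g0 : G) a : g @ Fl --> g0 -> infinitesimal Fl h a 0 ->
  infinitesimal Fl h (fun t => g t * a t * (g t)^-1)%g 0.
Proof.
move=> gg0 [a1 av].
have gi : (fun t => (g t)^-1)%g @ Fl --> g0^-1%g by exact: cvg_invg.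
have ga : (fun t => g t * a t)%g @ Fl --> g0 by rewrite -(mulg1 g0); exact: cvg_mulg.
split; first by rewrite -(mulgV g0); exact: cvg_mulg.
have cg1 : cdom (chart_at g0) (g0 * 1)%g by rewrite mulg1; exact: mem_chart_at.
have := mul_cvg_quotient FF (atlas_chart_at g0) (atlas_chart_at 1%g)
  (atlas_chart_at g0) (mem_chart_at g0) c11 cg1 h0 hn0 gg0 gg0 (cvg_cst 1%g) a1
  (cvg_quotient_cst FF h _ g) av.
rewrite mul_dderive0 => /(_ FF) H.
have H' : (fun t => (h t)^-1 *: (cmap (chart_at g0) (g t * a t)%g
    - cmap (chart_at g0) (g t))) @ Fl --> (0 : E).
  by apply: eq_cvg_to H => t; rewrite mulg1.
have cgg : cdom c1 (g0 * g0^-1)%g by rewrite mulgV.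
have := mul_cvg_quotient FF (atlas_chart_at g0) (atlas_chart_at g0^-1%g)
  (atlas_chart_at 1%g) (mem_chart_at g0) (mem_chart_at g0^-1%g) cgg h0 hn0 gg0 ga
  gi gi H' (cvg_quotient_cst FF h _ (fun t => (g t)^-1%g)).
by rewrite mul_dderive0; apply: eq_cvg_to => t; rewrite mulgV.
Qed.

(** Smoothness of the inversion shows that [a^-1] has some first order part; the
    product rule for [a * a^-1 = 1] identifies it. *)
Lemma infinitesimal_inv a v : ProperFilter Fl -> infinitesimal Fl h a v ->
  infinitesimal Fl h (fun t => (a t)^-1)%g (- v).
Proof.
move=> PF av; have [a1 av'] := av.
have c11' : cdom c1 1^-1%g by rewrite invg1.
have := smooth_map_cvg_quotient FF (@invg_smooth R E G) (atlas_chart_at 1%g)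
  (atlas_chart_at 1%g) c11 c11' h0 hn0 (cvg_cst 1%g) a1 av'.
set w := dderive _ _ _ => aiw.
have iw : infinitesimal Fl h (fun t => (a t)^-1)%g w.
  split; first by rewrite -invg1; exact: cvg_invg.
  by have := aiw FF; rewrite invg1.
suff -> : - v = w by [].
have [_] := infinitesimal_mul av iw.
rewrite (_ : (fun t => _) = cst 0); last first.
  by apply/funext => t; rewrite mulgV subrr scaler0.
move=> /(cvg_unique hE (cvg_cst 0))/esym/eqP; rewrite addrC addr_eq0 => /eqP ->.
by [].
Qed.

End Filtered.

End Infinitesimal.

(** * Curves and their generators *)

Section Curves.
Context {R : realType} {E : tvsType R} {G : lieGroupType E}.
Hypothesis hE : hausdorff_space E.
Implicit Types (gamma : R -> G) (b t : R) (X : E).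

Let c1 : chart G E := chart_at (1%g : G).

(** The filter of the steps [h] that tend to [0] and keep [t + h] in [[0, b]]; for
    [b = 1] it is the one that defines the derivative of a curve. *)
Definition steps b t : set_system R :=
  within [set h | `[0, b]%classic (t + h)] (0 : R)^'.

#[global] Typeclasses Opaque steps.

Global Instance steps_filter b t : Filter (steps b t).
Proof. exact: within_filter. Qed.

Lemma near_steps b t (P : R -> Prop) :
  (\forall h \near (0 : R), h != 0 -> 0 <= t + h <= b -> P h) ->
  \forall h \near steps b t, P h.
Proof.
move=> HP; rewrite /steps near_withinE near_withinE.
by apply: filterS HP => h HP h0; rewrite /= in_itv/=; exact: HP.
Qed.

Lemma steps_near b t (P : R -> Prop) :
  (\forall h \near steps b t, P h) ->
  \forall h \near (0 : R), h != 0 -> 0 <= t + h <= b -> P h.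
Proof.
rewrite /steps near_withinE near_withinE.
by apply: filterS => h HP h0 hb; apply: HP => //=; rewrite in_itv.
Qed.

Lemma steps_proper b t : 0 < b -> 0 <= t <= b -> ProperFilter (steps b t).
Proof.
move=> b0 /andP[t0 tb]; split; last exact: steps_filter.
move=> /steps_near/nbhs_ballP[e/= e0 H].
pose k := Num.min (e / 2) (b / 2).
have k0 : 0 < k by rewrite lt_min; apply/andP; split; lra.
have ke : k <= e / 2 by rewrite ge_min lexx.
have kb : k <= b / 2 by rewrite ge_min lexx orbT.
have [tb2|tb2] := leP t (b / 2).
  apply: (H k); rewrite ?gt_eqF//; last by apply/andP; split; lra.
  by rewrite /ball/= sub0r normrN gtr0_norm//; lra.
apply: (H (- k)); rewrite ?oppr_eq0 ?gt_eqF//; last by apply/andP; split; lra.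
by rewrite /ball/= sub0r opprK gtr0_norm//; lra.
Qed.

Lemma steps_cvg0 b t : id @ steps b t --> (0 : R).
Proof. by move=> U U0; apply: near_steps; apply: filterS U0. Qed.

Lemma steps_neq0 b t : \forall h \near steps b t, h != 0.
Proof. by apply: near_steps; near=> h. Unshelve. all: by end_near. Qed.

Lemma continuous_steps b t gamma : {within `[0, b], continuous gamma} ->
  0 <= t <= b -> (fun h => gamma (t + h)) @ steps b t --> gamma t.
Proof.
move=> /subspace_continuousP cg tb; have /cg gt : `[0, b]%classic t by rewrite /= in_itv/=.
have st : (fun h => t + h) @ steps b t --> within `[0, b]%classic (nbhs t).
  move=> U; rewrite /within/= => Ut; apply: near_steps.
  have ct : (fun h : R => t + h) @ (0 : R) --> t + 0.
    by apply: cvgD; [exact: cvg_cst|exact: cvg_id].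
  rewrite addr0 in ct.
  have : \forall h \near (0 : R), `[0, b]%classic (t + h) -> U (t + h) := ct _ Ut.
  by apply: filterS => h HU _ hb; apply: HU; rewrite /= in_itv/=.
exact: (cvg_comp _ _ st gt).
Qed.

Lemma steps_continuous b gamma :
  (forall t, 0 <= t <= b -> (fun h => gamma (t + h)) @ steps b t --> gamma t) ->
  {within `[0, b], continuous gamma}.
Proof.
move=> cg; apply/subspace_continuousP => t; rewrite /= in_itv/= => tb U Ut.
have H := steps_near (cg t tb U Ut).
have ct : (fun s : R => s - t) @ t --> t - t by apply: cvgB; [exact: cvg_id|exact: cvg_cst].
rewrite subrr in ct.
have : \forall s \near t, s - t != 0 -> 0 <= t + (s - t) <= b -> U (gamma (t + (s - t))) :=
  ct _ H.
rewrite /within/=; apply: filterS => s; rewrite [t + _]addrC subrK subr_eq0 in_itv/=.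
by have [-> _ _|_ Us /(Us isT)] := eqVneq s t; first exact: nbhs_singleton.
Qed.

(** The condition that [gamma] has constant right logarithmic derivative [X] on
    [[0, b]], stated with increments in the group instead of velocities in charts:
    it is stable under translations and products without any chain rule, and
    makes sense for curves that are not known to be [C1]. *)
Definition has_generator X b gamma :=
  gamma 0 = 1%g /\
  forall t, 0 <= t <= b ->
    infinitesimal (steps b t) id (fun h => gamma (t + h) * (gamma t)^-1)%g X.

Lemma has_generator_continuous X b gamma :
  has_generator X b gamma -> {within `[0, b], continuous gamma}.
Proof.
move=> [_ gX]; apply: steps_continuous => t /gX[g1 _].
apply: (@eq_cvg_to _ _ _ (fun h => gamma (t + h) * (gamma t)^-1 * gamma t)%g).
  by move=> h; rewrite mulgVK.
by rewrite -[X in _ --> X]mul1g; apply: cvg_mulg => //; exact: cvg_cst.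
Qed.

(** Freezing the second factor before or after differentiation is the same. *)
Lemma dderive_mulr (c d e : chart G E) g (k : G) v : cdom d k ->
  dderive (fun x => cmap e (cinv c x * k)%g) (cmap c g) v =
  mul_dderive c d e g k v 0.
Proof.
move=> dk; congr xget; apply/funext => l; rewrite /has_dderive/=.
have -> : (fun h : R => h^-1 *: (cmap e (cinv c (cmap c g + h *: v) * k)%g -
    cmap e (cinv c (cmap c g) * k)%g)) = (fun h : R => h^-1 *: (cmap e
  (cinv c (cmap c g + h *: v) * cinv d (cmap d k + h *: 0))%g -
  cmap e (cinv c (cmap c g) * cinv d (cmap d k))%g)).
  by apply/funext => h; rewrite scaler0 addr0 (cmapK dk).
by [].
Qed.

(** Multiply the increment of [gamma] by the constant [(gamma t)^-1] on the
    right: by the definition of the tangent map, the first order part is the right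
    logarithmic derivative. *)
Lemma C1_curve_infinitesimal gamma t : C1_curve gamma -> 0 <= t <= 1 ->
  infinitesimal (steps 1 t) id (fun h => gamma (t + h) * (gamma t)^-1)%g
    (rlogderive gamma t).
Proof.
move=> [cg dg] t01; have gt := continuous_steps cg t01.
split.
  by rewrite -(mulgV (gamma t)); apply: cvg_mulg => //; exact: cvg_cst.
have [t' _] := dg (chart_at (gamma t)) (atlas_chart_at (gamma t)).
have /t' : [set s | `[0, 1]%classic s /\ cdom (chart_at (gamma t)) (gamma s)] t.
  by split; [rewrite /= in_itv/=|exact: mem_chart_at].
move=> /(xgetPex 0) vt.
have cgg : cdom c1 (gamma t * (gamma t)^-1)%g by rewrite mulgV; exact: mem_chart_at.
have := mul_cvg_quotient _ (atlas_chart_at (gamma t)) (atlas_chart_at (gamma t)^-1%g)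
  (atlas_chart_at 1%g) (mem_chart_at (gamma t)) (mem_chart_at (gamma t)^-1%g) cgg
  (@steps_cvg0 1 t) (@steps_neq0 1 t) (cvg_cst (gamma t)) gt
  (cvg_cst (gamma t)^-1%g) (cvg_cst (gamma t)^-1%g) vt (cvg_quotient_cst (@steps_filter 1 t) id _ (cst _)).
rewrite -dderive_mulr; last exact: mem_chart_at.
rewrite /rlogderive /tangent_map /right_translation mulgV; exact.
Qed.

Lemma exp_curve_has_generator X gamma : exp_curve X gamma -> has_generator X 1 gamma.
Proof.
move=> [Cg g0 gX]; split => // t t01.
by rewrite -(gX t) ?/= ?in_itv//; exact: C1_curve_infinitesimal.
Qed.

(** Undo the translation: [gamma (t + h)] is [gamma (t + h) * (gamma t)^-1] times
    [gamma t]. The formula for the velocity depends continuously on [gamma t],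
    which is why generated curves are [C1]. *)
Lemma has_generator_cderive X gamma (d : chart G E) t : has_generator X 1 gamma ->
  atlas d -> 0 <= t <= 1 -> cdom d (gamma t) ->
  has_cderive (cmap d \o gamma) t (mul_dderive c1 d d 1%g (gamma t) X 0).
Proof.
move=> [g0 gX] Ad t01 dt; have [a1 aX] := gX t t01.
have d1t : cdom d (1 * gamma t)%g by rewrite mul1g.
have := mul_cvg_quotient _ (atlas_chart_at 1%g) Ad Ad (mem_chart_at 1%g) dt d1t
  (@steps_cvg0 1 t) (@steps_neq0 1 t) (cvg_cst 1%g) a1 (cvg_cst (gamma t))
  (cvg_cst (gamma t)) aX (cvg_quotient_cst (@steps_filter 1 t) id _ (cst _)).
by move=> H; apply: eq_cvg_to (H _ _ _ _) => h; rewrite /= mulgVK mul1g.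
Qed.

Lemma cderiveE (f : R -> E) t l : 0 <= t <= 1 -> has_cderive f t l -> cderive f t = l.
Proof.
move=> t01 fl; have PF : ProperFilter (within [set h | `[0, 1]%classic (t + h)] (0 : R)^').
  exact: (steps_proper ltr01 t01).
by apply: (cvg_unique hE _ fl); apply: (xgetPex 0); exists l.
Qed.

Lemma has_generator_exp_curve X gamma : has_generator X 1 gamma -> exp_curve X gamma.
Proof.
move=> gX; have [g0 agX] := gX; have cg := has_generator_continuous gX.
have C1 : C1_curve gamma.
  split => // d Ad S; split=> [t [t01 dt]|].
    exists (mul_dderive c1 d d 1%g (gamma t) X 0).
    by apply: has_generator_cderive => //; rewrite /= in_itv in t01.
  have dE t : S t -> cderive (cmap d \o gamma) t = mul_dderive c1 d d 1%g (gamma t) X 0.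
    move=> [t01 dt]; rewrite /= in_itv/= in t01.
    by apply: cderiveE => //; exact: has_generator_cderive.
  apply/subspace_continuousP => t St; have [t01 dt] := St.
  suff : (fun s => mul_dderive c1 d d 1%g (gamma s) X 0) @ within S (nbhs t) -->
      mul_dderive c1 d d 1%g (gamma t) X 0.
    rewrite -dE//; apply: cvg_trans; apply: near_eq_cvg.
    by rewrite near_withinE; apply: nearW => s Ss; rewrite /from_subspace dE.
  have pA : prod_atlas atlas atlas (prod_chart c1 d).
    by exists c1; [exact: atlas_chart_at|exists d].
  have dt' : cdom d (1 * gamma t)%g by rewrite mul1g.
  have U0 := chart_image_nbhs (c := prod_chart c1 d) (p := (1%g, gamma t))
    (@mulg_smooth R E G).1 (conj (mem_chart_at 1%g) dt) dt'.
  have dc := smooth_on_dderive_continuous (w0 := (X, 0))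
    ((@mulg_smooth R E G).2 _ _ pA Ad) (nbhs_singleton U0).
  have cc : (fun s => cmap d (gamma s)) @ within S (nbhs t) --> cmap d (gamma t).
    have gt : gamma @ within S (nbhs t) --> gamma t.
      move/subspace_continuousP : cg => /(_ _ t01) cgt U Ut.
      have : \forall s \near t, `[0, 1]%classic s -> U (gamma s) := cgt U Ut.
      by apply: filterS => s H [s01 _]; exact: H.
    exact: (cvg_comp _ _ gt (cmap_continuous dt)).
  pose z s : (E * E) * (E * E) := ((cmap c1 1%g, cmap d (gamma s)), (X, 0)).
  have zc : z @ within S (nbhs t) --> z t.
    exact: (cvg_pair (cvg_pair (cvg_cst _) cc) (cvg_cst _)).
  exact: (cvg_comp _ _ zc dc).
split => // t; rewrite /= in_itv/= => t01.
have PF : ProperFilter (steps 1 t) by exact: steps_proper.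
exact: (cvg_unique hE (C1_curve_infinitesimal C1 t01).2 (agX t t01).2).
Qed.

Lemma C1_curve_infinitesimal0 (mu : R -> G) : C1_curve mu -> mu 0 = 1%g ->
  infinitesimal (steps 1 0) id mu (velocity mu 0).
Proof.
move=> [cmu dmu] mu0; have t01 : 0 <= (0 : R) <= (1 : R) by rewrite lexx ler01.
split.
  have := continuous_steps cmu t01; rewrite mu0; apply: eq_cvg_to => h.
  by rewrite add0r.
have {}dmu := (dmu (chart_at (mu 0)) (atlas_chart_at (mu 0))).1.
have vmu : has_cderive (cmap (chart_at (mu 0)) \o mu) 0 (velocity mu 0).
  by apply: (xgetPex 0); apply: dmu; split; [rewrite /= in_itv|exact: mem_chart_at].
have {}vmu : (fun h => h^-1 *: (cmap (chart_at (mu 0)) (mu (0 + h)) -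
  cmap (chart_at (mu 0)) (mu 0))) @ steps 1 0 --> velocity mu 0 := vmu.
by apply: eq_cvg_to vmu => h; rewrite add0r mu0.
Qed.

End Curves.

(** * Consequences of local mu-convexity *)

Section MuConvexity.
Context {R : realType} {E : tvsType R} {G : lieGroupType E}.
Hypothesis hE : hausdorff_space E.
Hypothesis muG : locally_mu_convex G.

Let c1 : chart G E := chart_at (1%g : G).

(** The seminorm [q] in the chart at [1], translated so as to send [1] to [0]. *)
Definition chart_size (q : E -> R) (a : G) : R := q (cmap c1 a - cmap c1 1%g).

(** Local mu-convexity in the form in which it is used: finite products of
    elements of small total size stay in [U]. *)
Lemma mu_convex_nbhs (U : set G) : nbhs (1%g : G) U ->
  exists2 q, continuous_seminorm q &
    forall s : seq G, (forall a, a \in s -> cdom c1 a) ->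
      \sum_(a <- s) chart_size q a < 1 -> U (\prod_(a <- s) a)%g.
Proof.
move=> U1; pose c := translated_chart c1 (cmap c1 1%g).
have c11 : cdom c 1%g by exact: (mem_chart_at (1%g : G)).
have c0 : cmap c 1%g = 0 by rewrite /= subrr.
have chc : is_chart G c.
  move=> d Ad; apply: compatible_translated_chart.
  by apply: atlas_compatible => //; exact: atlas_chart_at.
have cc0 : cinv c @ (0 : E) --> (1%g : G).
  rewrite -[X in _ --> X](cmapK c11) -c0; apply: cinv_continuous.
  exact: cmap_ccod.
have [u cu uU] := nbhs_seminorm (cc0 _ U1).
have [q [cq uq Ho]] := muG cu chc c11 c0.
exists q => // s sc sq; have [s0|s_gt0] := posnP (size s).
  by rewrite (size0nil s0) big_nil; exact: nbhs_singleton.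
pose X (i : 'I_(size s)) := cmap c (tnth (in_tuple s) i).
have EX : \sum_(i < size s) q (X i) = \sum_(a <- s) chart_size q a.
  by rewrite [RHS]big_tnth.
have PX : (\prod_(i < size s) cinv c (X i) = \prod_(a <- s) a)%g.
  rewrite [RHS]big_tnth; apply: eq_bigr => i _.
  by rewrite cmapK//; apply: sc; exact: mem_tnth.
have := Ho _ X s_gt0; rewrite EX PX => /(_ (ltW sq))[_ cP uP].
by rewrite -(cmapK cP); apply: uU; exact: le_lt_trans sq.
Qed.

Lemma infinitesimal_small q e (T : Type) (Fl : set_system T) (h : T -> R) (a : T -> G) :
  Filter Fl -> (\forall t \near Fl, h t != 0) ->
  continuous_seminorm q -> 0 < e -> infinitesimal Fl h a 0 ->
  \forall t \near Fl, cdom c1 (a t) /\ chart_size q (a t) <= e * `|h t|.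
Proof.
move=> FF hn0 cq e0 [a1 av].
have H1 : \forall t \near Fl, cdom c1 (a t) := a1 _ (chart_domain_nbhs (mem_chart_at _)).
have H2 : \forall t \near Fl, q ((h t)^-1 *: (cmap c1 (a t) - cmap c1 1%g) - 0) < e.
  exact: (tvs_cvgP _ _).1 av q e cq e0.
near=> t; split; first by near: t.
have ht : h t != 0 by near: t.
have : q ((h t)^-1 *: (cmap c1 (a t) - cmap c1 1%g) - 0) < e by near: t.
rewrite subr0 seminormZ// normfV ltr_pdivrMl ?normr_gt0// mulrC; exact: ltW.
Unshelve. all: by end_near. Qed.

(** A mean value theorem in the group: the increments of [eta] over a fine
    subdivision have total size less than [1] for any given seminorm, so local
    mu-convexity keeps their product [(eta 0)^-1 * eta b] in any given
    neighbourhood of [1], and the group is Hausdorff. *)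
Lemma infinitesimal_constant b (eta : R -> G) : 0 <= b ->
  (forall t, 0 <= t <= b ->
     infinitesimal (steps b t) id (fun h => (eta t)^-1 * eta (t + h))%g 0) ->
  eta b = eta 0.
Proof.
move=> b0 H; have [->//|bn0] := eqVneq b 0.
have {b0 bn0} b0 : 0 < b by rewrite lt_neqAle eq_sym bn0.
suff HS (U : set G) : nbhs (1%g : G) U -> U ((eta 0)^-1 * eta b)%g.
  apply/esym/(@mulgI _ (eta 0)^-1%g); rewrite mulVg.
  apply: (lie_group_hausdorff (s := G)) => A B A1 By.
  by exists ((eta 0)^-1 * eta b)%g; split; [exact: HS|exact: nbhs_singleton].
move=> /mu_convex_nbhs[q cq qU].
(* so that the total size is at most [e * b = 1 / 2] *)
pose e := (2 * b)^-1.
have e0 : 0 < e by rewrite invr_gt0; lra.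
(* [P s t]: the increment from [s] to [t] is a product of total size at most
   [e * (t - s)] *)
pose P s t := exists2 xs : seq G, (forall a, a \in xs -> cdom c1 a) &
  \sum_(a <- xs) chart_size q a <= e * (t - s) /\
  ((eta s)^-1 * eta t = \prod_(a <- xs) a)%g.
have [xs xsc [xse ->]] : P 0 b.
  apply: interval_chain; first exact: ltW.
    move=> s t u _ [xs xsc [xse xsp]] [ys ysc [yse ysp]].
    exists (xs ++ ys); first by move=> a; rewrite mem_cat => /orP[/xsc|/ysc].
    rewrite !big_cat/=; split; first lra.
    by rewrite -xsp -ysp mulgA mulgK.
  move=> t tb; have PF := steps_proper b0 tb.
  have small := fun a => infinitesimal_small (a := a) _ (steps_neq0 b t) cq e0.
  have S1 := steps_near (small _ _ (H t tb)).
  have Hi := infinitesimal_inv hE _ (@steps_cvg0 _ b t) (steps_neq0 b t) PF (H t tb).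
  rewrite oppr0 in Hi.
  have S2 := steps_near (small _ _ (Hi _)).
  near=> h => thb.
  have [->|h0] := eqVneq h 0.
    rewrite addr0.
    suff Ptt : P t t by [].
    by exists [::] => //; rewrite !big_nil subrr mulr0 mulVg.
  split=> hs.
    have [ca wa] : cdom c1 ((eta t)^-1 * eta (t + h))%g /\
        chart_size q ((eta t)^-1 * eta (t + h))%g <= e * `|h|.
      by move: h0 thb; near: h; exact: S1.
    exists [:: ((eta t)^-1 * eta (t + h))%g]; first by move=> a; rewrite inE => /eqP ->.
    by rewrite !big_seq1 [t + h - t](_ : _ = `|h|)//; rewrite ger0_norm//; lra.
  have [ca wa] : cdom c1 ((eta t)^-1 * eta (t + h))^-1%g /\
      chart_size q ((eta t)^-1 * eta (t + h))^-1%g <= e * `|h|.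
    by move: h0 thb; near: h; exact: S2.
  exists [:: ((eta t)^-1 * eta (t + h))^-1%g]; first by move=> a; rewrite inE => /eqP ->.
  rewrite !big_seq1 [t - (t + h)](_ : _ = `|h|); last by rewrite ler0_norm//; lra.
  by split=> //; rewrite invgM invgK.
apply: qU => //; apply: (le_lt_trans xse); rewrite subr0 /e invfM mulfVK ?gt_eqF//; lra.
Unshelve. all: by end_near. Qed.

End MuConvexity.

(** * One-parameter semigroups and the exponential map *)

Section OneParameter.
Context {R : realType} {E : tvsType R} {G : lieGroupType E}.
Hypothesis hE : hausdorff_space E.
Hypothesis muG : locally_mu_convex G.
Implicit Types (gamma : R -> G) (X : E).

Let c1 : chart G E := chart_at (1%g : G).

Lemma steps_sub (b b' t t' : R) :
  (forall h, 0 <= t + h <= b -> 0 <= t' + h <= b') -> steps b t `=>` steps b' t'.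
Proof.
move=> H U /steps_near HU; apply: near_steps.
by apply: filterS HU => h HU h0 /H; exact: HU.
Qed.

(** The increments of [gamma^-1 * gamma'] are conjugates of quotients of
    increments with the same first order part [X], so they vanish to first
    order. *)
Lemma has_generator_unique X b gamma gamma' : 0 < b ->
  has_generator X b gamma -> has_generator X b gamma' -> gamma b = gamma' b.
Proof.
move=> b0 [g0 gX] [g'0 g'X].
pose eta t := ((gamma t)^-1 * gamma' t)%g.
suff : eta b = eta 0.
  rewrite /eta g0 g'0 invg1 mulg1 => /(congr1 (fun x => gamma b * x)%g).
  by rewrite mulVKg mulg1 => ->.
apply: (infinitesimal_constant hE muG) => [|t tb]; first exact: ltW.
have PF := steps_proper b0 tb; have SF := @steps_filter R b t.
have st0 := @steps_cvg0 R b t; have sn0 := @steps_neq0 R b t.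
have Hi := infinitesimal_inv hE SF st0 sn0 PF (gX t tb).
have := infinitesimal_mul hE SF st0 sn0 Hi (g'X t tb); rewrite addNr => Hm.
have := infinitesimal_conj0 hE SF st0 sn0 (cvg_cst (gamma' t)^-1%g) Hm.
move=> /(_ SF); apply: infinitesimal_ext => h.
by rewrite /eta /cst invgK !invgM !invgK !mulgA mulgVK.
Qed.

Lemma has_generator_shift X b b' t0 gamma : 0 <= t0 -> t0 + b' <= b ->
  has_generator X b gamma ->
  has_generator X b' (fun s => gamma (s + t0) * (gamma t0)^-1)%g.
Proof.
move=> t00 tb [g0 gX]; split; first by rewrite add0r mulgV.
move=> s /andP[s0 sb].
have /gX gs : 0 <= s + t0 <= b by apply/andP; split; lra.
apply: infinitesimal_ext (infinitesimal_sub _ gs) => [h|]; last first.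
  by apply: steps_sub => h /andP[h0 hb]; apply/andP; split; lra.
by rewrite invgM invgK mulgA mulgVK addrAC.
Qed.

(** Both [gamma] and its translate [r |-> gamma (r + t) * (gamma t)^-1] are
    generated by [X], so uniqueness identifies them. *)
Lemma has_generatorD X b gamma s t : has_generator X b gamma ->
  0 <= s -> 0 <= t -> s + t <= b -> gamma (s + t) = (gamma s * gamma t)%g.
Proof.
move=> gX s0 t0 stb; have [->|sn0] := eqVneq s 0.
  by case: gX => -> _; rewrite add0r mul1g.
have {}s0 : 0 < s by rewrite lt_neqAle eq_sym sn0.
have g1 : has_generator X s (fun r => gamma (r + t) * (gamma t)^-1)%g.
  by apply: has_generator_shift gX => //; lra.
have g2 : has_generator X s (fun r => gamma (r + 0) * (gamma 0)^-1)%g.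
  by apply: has_generator_shift gX => //; lra.
have := has_generator_unique s0 g1 g2.
case: gX => -> _; rewrite addr0 invg1 mulg1 => <-.
by rewrite mulgVK.
Qed.

Definition additive_on b (Phi : R -> G) :=
  forall s t, 0 <= s -> 0 <= t -> s + t <= b -> Phi (s + t) = (Phi s * Phi t)%g.

Lemma additive_on0 b Phi : 0 <= b -> additive_on b Phi -> Phi 0 = 1%g.
Proof.
move=> b0 /(_ 0 0 (lexx _) (lexx _)); rewrite addr0 => /(_ b0) e.
by apply: (@mulgI _ (Phi 0)); rewrite mulg1 -e.
Qed.

Lemma additive_onX b Phi n s : 0 <= b -> additive_on b Phi ->
  0 <= s -> n%:R * s <= b -> Phi (n%:R * s) = (Phi s ^+ n)%g.
Proof.
move=> b0 aP s0; elim: n => [|n IH] nb.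
  by rewrite mul0r expg0 (additive_on0 b0 aP).
rewrite -natr1 mulrDl mul1r in nb *.
have ns0 : 0 <= n%:R * s by rewrite mulr_ge0.
by rewrite aP// expgSr IH//; lra.
Qed.

(** The increments of an additive curve do not depend on the point: forward ones
    are values of [Phi] near [0], and backward ones are their inverses. Hence
    one-sided information at [0] is enough. *)
Lemma additive_on_has_generator X b Phi : 0 < b -> additive_on b Phi ->
  infinitesimal (steps b 0) id Phi X -> has_generator X b Phi.
Proof.
move=> b0 aP P1; have P0 := additive_on0 (ltW b0) aP; split=> // t tb.
have b00 : (0 : R) <= 0 <= b by apply/andP; split; lra.
have PF := steps_proper b0 b00.
have [i1 iX] := infinitesimal_inv hE (@steps_filter R b 0) (@steps_cvg0 _ b 0)
  (@steps_neq0 _ b 0) PF P1.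
pose a h := (Phi (t + h) * (Phi t)^-1)%g.
have apos h : 0 <= h -> t + h <= b -> a h = Phi h.
  move=> h0 hb; rewrite /a addrC aP//; [exact: mulgK|by case/andP: tb|lra].
have aneg h : 0 <= h -> 0 <= t - h -> a (- h) = (Phi h)^-1%g.
  move=> h0 hb; case/andP: tb => t0 tb'.
  have := aP h (t - h) h0 hb; rewrite addrC subrK => /(_ tb') e.
  by rewrite /a e invgM mulgA mulgV mul1g.
have split_steps (P : R -> Prop) :
   (\forall h \near steps b 0, t + h <= b -> P h) ->
   (\forall h \near steps b 0, 0 <= t - h -> P (- h)) -> \forall h \near steps b t, P h.
  move=> /steps_near H1 /steps_near H2; apply: near_steps.
  have {}H2 : \forall h \near (0 : R), - h != 0 -> 0 <= 0 + - h <= b ->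
      0 <= t - - h -> P (- - h).
    have c0 : (fun h : R => - h) @ (0 : R) --> - (0 : R) by apply: cvgN; exact: cvg_id.
    by rewrite oppr0 in c0; exact: (c0 _ H2).
  near=> h => hn0 /andP[th0 thb]; case/andP: tb => t0 tb.
  have [h0|/ltW h0] := leP 0 h.
    suff : h != 0 -> 0 <= 0 + h <= b -> t + h <= b -> P h.
      by apply => //; apply/andP; split; lra.
    by near: h.
  rewrite -[h]opprK.
  suff : - h != 0 -> 0 <= 0 + - h <= b -> 0 <= t - - h -> P (- - h).
    by apply; rewrite ?oppr_eq0 ?opprK//; apply/andP; split; lra.
  by near: h.
have [p1 pX] := P1.
have pos0 : \forall h \near steps b 0, 0 <= h.
  by apply: near_steps; near=> h => _; rewrite add0r => /andP[].
split.
  move=> U U1; apply: split_steps.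
    have H : \forall h \near steps b 0, U (Phi h) := p1 _ U1.
    near=> h => hb; rewrite /= -/(a h) apos//; near: h => //.
  have H : \forall h \near steps b 0, U (Phi h)^-1%g := i1 _ U1.
  near=> h => hb; rewrite /= -/(a (- h)) aneg//; near: h => //.
move=> U UX; apply: split_steps.
  have H : \forall h \near steps b 0, U (h^-1 *: (cmap c1 (Phi h) - cmap c1 1%g)) :=
    pX _ UX.
  near=> h => hb; rewrite /= -/(a h) apos//; near: h => //.
have H : \forall h \near steps b 0, U (- (h^-1 *: (cmap c1 (Phi h)^-1%g - cmap c1 1%g))).
  by apply: (tvs_cvgN iX); rewrite opprK.
near=> h => hb; rewrite /= -/(a (- h)) aneg//; last by near: h.
by rewrite invrN scaleNr; near: h.
Unshelve. all: by end_near. Qed.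

End OneParameter.

Section Exponential.
Context {R : realType} {E : tvsType R} {G : lieGroupType E}.
Hypothesis hE : hausdorff_space E.
Hypothesis muG : locally_mu_convex G.
Implicit Types (gamma : R -> G) (X : E).

(** The values of [gamma] commute, as they are squares of values on [[0, 1 / 2]],
    where additivity applies in both orders. So the power is additive on the longer
    interval, and near [0] it agrees with [gamma]. *)
Lemma has_generator_extend X gamma n : has_generator X 1 gamma ->
  has_generator X n.+1%:R (fun s => gamma (s / n.+1%:R)%R ^+ n.+1)%g.
Proof.
move=> gX; set m : R := n.+1%:R; have m0 : 0 < m by rewrite ltr0n.
have aP : additive_on 1 gamma by move=> s t; exact: has_generatorD gX.
have m1 : 1 <= m by rewrite ler1n.
have bound s : s <= m -> s / m <= 1 by move=> sm; rewrite ler_pdivrMr// mul1r.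
have pos s : 0 <= s -> 0 <= s / m by move=> s0; rewrite divr_ge0// ltW.
have comm s t : 0 <= s <= 1 -> 0 <= t <= 1 -> commute (gamma s) (gamma t).
  move=> /andP[s0 s1] /andP[t0 t1].
  have -> : gamma s = (gamma (s / 2)%R ^+ 2)%g.
    by rewrite -(additive_onX ler01 aP); [congr gamma; lra|lra|lra].
  have -> : gamma t = (gamma (t / 2)%R ^+ 2)%g.
    by rewrite -(additive_onX ler01 aP); [congr gamma; lra|lra|lra].
  apply: commuteX2; rewrite /commute -!aP; [|lra..].
  by congr gamma; lra.
apply: additive_on_has_generator => //.
  move=> s t s0 t0 st; rewrite mulrDl aP ?pos//; last first.
    by rewrite -mulrDl bound.
  have sm : s <= m by lra.
  have tm : t <= m by lra.
  by apply: expgMn; apply: comm; rewrite pos//= bound.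
have [g0 gX'] := gX.
have g1 : infinitesimal (steps 1 0) id gamma X.
  have b00 : 0 <= (0 : R) <= (1 : R) by rewrite lexx ler01.
  by apply: infinitesimal_ext (gX' 0 b00) => h; rewrite g0 invg1 mulg1 add0r.
apply: (infinitesimal_near (a := gamma)); last first.
  apply: infinitesimal_sub g1 => U /steps_near HU; apply: near_steps.
  have h1 : \forall h \near (0 : R), h < 1 by exact: lt_nbhsl.
  near=> h => h0; rewrite add0r => /andP[hp hm].
  suff : h != 0 -> 0 <= 0 + h <= 1 -> U h.
    have : h < 1 by near: h.
    by move=> hlt; apply => //; rewrite add0r hp ltW.
  by near: h.
apply: near_steps.
have h1 : \forall h \near (0 : R), h < 1 by exact: lt_nbhsl.
near=> h => h0; rewrite add0r => /andP[hp hm].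
have hlt : h < 1 by near: h.
rewrite -(additive_onX ler01 aP) ?pos//.
  by rewrite mulrC divfK ?gt_eqF.
by rewrite mulrC divfK ?gt_eqF// ltW.
Unshelve. all: by end_near. Qed.

Lemma has_generator_scale X b tau gamma : 0 <= tau <= b ->
  has_generator X b gamma -> has_generator (tau *: X) 1 (fun t => gamma (tau * t)).
Proof.
move=> /andP[tau0 taub] [g0 gX]; split=> [|t t01]; first by rewrite mulr0.
have [->|taun0] := eqVneq tau 0.
  split; first by apply: eq_cvg_to (cvg_cst (1%g : G)) => h; rewrite !mul0r mulgV.
  rewrite scale0r; apply: eq_cvg_to (cvg_cst (0 : E)) => h.
  by rewrite !mul0r mulgV subrr scaler0.
have {}tau0 : 0 < tau by rewrite lt_neqAle eq_sym taun0.
have in_b r : 0 <= r <= 1 -> 0 <= tau * r <= b.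
  move=> /andP[r0 r1]; rewrite mulr_ge0 ?(ltW tau0)//=.
  by apply: le_trans taub; rewrite ler_piMr ?(ltW tau0).
have sc : (fun h => tau * h) @ steps 1 t --> steps b (tau * t).
  move=> U /steps_near HU; apply: near_steps.
  have c0 : (fun h : R => tau * h) @ (0 : R) --> tau * (0 : R).
    by apply: cvgM; [exact: cvg_cst|exact: cvg_id].
  rewrite mulr0 in c0.
  have : \forall h \near (0 : R), tau * h != 0 -> 0 <= tau * t + tau * h <= b ->
    U (tau * h) := c0 _ HU.
  apply: filterS => h HUh h0 thb; apply: HUh; first by rewrite mulf_neq0.
  by rewrite -mulrDr; exact: in_b.
have [a1 aX] := infinitesimal_comp sc (gX _ (in_b _ t01)).
split; first by apply: eq_cvg_to a1 => h; rewrite /= mulrDr.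
apply: eq_cvg_to (tvs_cvgZ (cvg_cst tau) aX) => h.
by rewrite /= scalerA mulrDr invfM mulrA divff// mul1r.
Qed.

(** By uniqueness, the choice of a curve in [lie_exp] is irrelevant. *)
Lemma lie_exp_generator X b tau gamma : 0 <= tau <= b ->
  has_generator X b gamma -> lie_exp (tau *: X) = gamma tau.
Proof.
move=> taub gX; have sX := has_generator_scale taub gX.
apply: xget_unique.
  by exists (fun t => gamma (tau * t)); [exact: has_generator_exp_curve|rewrite mulr1].
move=> _ [gamma' /exp_curve_has_generator g'X <-].
by rewrite (has_generator_unique hE muG ltr01 g'X sX) mulr1.
Qed.

End Exponential.

(** * The Trotter property *)

Section Trotter.
Context {R : realType} {E : tvsType R} {G : lieGroupType E}.
Hypothesis hE : hausdorff_space E.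

Let c1 : chart G E := chart_at (1%g : G).

(** This turns neighbourhoods [U * Phi s] into neighbourhoods [Phi s * U], for all
    [s] at once: [(s, p) |-> (Phi s)^-1 * p * Phi s] is continuous and sends
    [(s, 1)] to [1], and [[0, b]] is compact. *)
Lemma compact_near_conj_nbhs (b : R) (Phi : R -> G) (U : set G) :
  {within `[0, b], continuous Phi} -> nbhs (1%g : G) U ->
  \forall p \near (1%g : G), forall s, 0 <= s <= b ->
    U ((Phi s)^-1 * p * Phi s)%g.
Proof.
move=> cP U1.
have /compact_near_coveringP/near_covering_withinP := @segment_compact R 0 b.
move=> /(_ G (nbhs (1%g : G)) (fun p s => U ((Phi s)^-1 * p * Phi s)%g) _) H.
have : \forall p \near (1%g : G), `[0, b] `<=` (fun s => U ((Phi s)^-1 * p * Phi s)%g).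
  apply: H => s sb.
  move/subspace_continuousP : cP => /(_ _ sb) cs.
  pose Fl := filter_prod (within `[0, b] (nbhs s)) (nbhs (1%g : G)).
  have FF : Filter Fl by exact: filter_prod_filter.
  have fc : (fun z : R * G => Phi z.1) @ Fl --> Phi s by exact: (cvg_comp _ _ cvg_fst cs).
  have sc : (fun z : R * G => z.2) @ Fl --> (1%g : G) by exact: cvg_snd.
  have := cvg_mulg FF (cvg_mulg FF (cvg_invg FF fc) sc) fc.
  rewrite mulg1 mulVg.
  move=> /(_ _ U1)[[A B]/= [A1 B1] AB].
  exists ((fun x => `[0, b]%classic x -> A x), B) => //= -[x p] /= [Ax Bp] /Ax Ax'.
  exact: (AB (x, p)).
by apply: filterS => p H' s sb; apply: H'; rewrite /= in_itv.
Qed.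

(** For each [s0], [infinitesimal_conj0] gives the estimate for all [s] near [s0],
    with [s] and [h] varying independently; finitely many [s0] suffice. *)
Lemma compact_conj_small (b b' e : R) q (Phi d : R -> G) :
  {within `[0, b], continuous Phi} -> continuous_seminorm q -> 0 < e ->
  infinitesimal (steps b' 0) id d 0 ->
  \forall h \near steps b' 0, forall s, 0 <= s <= b ->
    cdom c1 (Phi s * d h * (Phi s)^-1)%g /\
    chart_size q (Phi s * d h * (Phi s)^-1)%g <= e * `|h|.
Proof.
move=> cP cq e0 d0.
have /compact_near_coveringP/near_covering_withinP := @segment_compact R 0 b.
pose P h s := cdom c1 (Phi s * d h * (Phi s)^-1)%g /\
    chart_size q (Phi s * d h * (Phi s)^-1)%g <= e * `|h|.
move=> /(_ R (steps b' 0) P _) H.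
have : \forall h \near steps b' 0, `[0, b] `<=` P h.
  apply: H => s sb.
  move/subspace_continuousP : cP => /(_ _ sb) cs.
  pose Fl := filter_prod (within `[0, b] (nbhs s)) (steps b' 0).
  have FF : Filter Fl by exact: filter_prod_filter.
  have fc : (fun z => Phi z.1) @ Fl --> Phi s by exact: (cvg_comp _ _ cvg_fst cs).
  have sndc : (fun z : R * R => z.2) @ Fl --> steps b' 0 by exact: cvg_snd.
  have h0 : (fun z : R * R => z.2) @ Fl --> (0 : R).
    exact: (cvg_comp _ _ sndc (@steps_cvg0 R b' 0)).
  have hn0 : \forall z \near Fl, z.2 != 0 by exact: (sndc _ (@steps_neq0 R b' 0)).
  have cj := infinitesimal_conj0 hE FF h0 hn0 fc (infinitesimal_comp sndc d0).
  have [[A B]/= [A1 B1] AB] := infinitesimal_small FF hn0 cq e0 cj.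
  exists ((fun x => `[0, b]%classic x -> A x), B) => //= -[x h] /= [Ax Bh] /Ax Ax'.
  exact: (AB (x, h)).
by apply: filterS => p H' s sb; apply: H'; rewrite /= in_itv.
Qed.

(** The first [n] factors end with [(b ^+ n)^-1], which cancels with the [b ^+ n]
    at the left of the next one. So the error [a * b^-1], made [n] times, becomes
    one product of [n] small elements. *)
Lemma expg_quotient (a b : G) n :
  (a ^+ n * (b ^+ n)^-1 = \prod_(0 <= i < n) (b ^+ i * (a * b^-1) * (b ^+ i)^-1))%g.
Proof.
elim: n => [|n IH]; first by rewrite big_geq// !expg0 invg1 mulg1.
by rewrite big_nat_recr//= -IH !expgSr invgM !mulgA mulgVK.
Qed.

(** The curves [mu] and [Phi] have the same velocity at [0]. *)
Lemma C1_curve_generator_quotient (mu Phi : R -> G) b : C1_curve mu -> mu 0 = 1%g ->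
  1 <= b -> has_generator (velocity mu 0) b Phi ->
  infinitesimal (steps 1 0) id (fun h => mu h * (Phi h)^-1)%g 0.
Proof.
move=> C1mu mu0 b1 [P0 gP].
have t01 : 0 <= (0 : R) <= (1 : R) by rewrite lexx ler01.
have t0b : 0 <= (0 : R) <= b by rewrite lexx (le_trans ler01).
have [SF PF] := (@steps_filter R 1 0, steps_proper ltr01 t01).
have st0 := @steps_cvg0 R 1 0; have sn0 := @steps_neq0 R 1 0.
have PX : infinitesimal (steps 1 0) id Phi (velocity mu 0).
  apply: infinitesimal_ext (infinitesimal_sub _ (gP 0 t0b)) => [h|].
    by rewrite add0r P0 invg1 mulg1.
  by apply: steps_sub => h; rewrite add0r => /andP[-> h1]; exact: le_trans b1.
have muX := C1_curve_infinitesimal0 C1mu mu0.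
have := infinitesimal_mul hE SF st0 sn0 muX (infinitesimal_inv hE SF st0 sn0 PF PX).
by rewrite subrr.
Qed.

End Trotter.

Theorem theorem1 (R : realType) (E : tvsType R) (G : lieGroupType E) :
  hausdorff_space E -> locally_mu_convex G -> strong_trotter G.
Proof.
move=> hE muG mu C1mu mu0 [gamma0 /exp_curve_has_generator g0X] l l0 U U1.
set X := velocity mu 0 in g0X *.
have [n0 ln0] : exists n, l < n.+1%:R :> R.
  exists (Num.truncn l); exact: truncnS_gt.
have gX := has_generator_extend hE muG n0 g0X.
move: gX; set b : R := n0.+1%:R; set Phi := (fun s : R => _) => gX.
have expE tau : 0 <= tau <= l -> lie_exp (tau *: X) = Phi tau.
  move=> /andP[t0 tl]; apply: (lie_exp_generator hE muG _ gX).
  by rewrite t0 (le_trans tl)// ltW.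
have cP := has_generator_continuous gX.
have b0 : 0 < b by rewrite ltr0n.
have aP : additive_on b Phi by move=> s t; exact: has_generatorD gX.
have P0 := additive_on0 (ltW b0) aP.
have b1 : 1 <= b by rewrite ler1n.
have d0 := C1_curve_generator_quotient hE C1mu mu0 b1 gX.
have W1 : \forall p \near (1%g : G), U p /\
    forall s, 0 <= s <= b -> U ((Phi s)^-1 * p * Phi s)%g.
  by apply: filterI => //; exact: compact_near_conj_nbhs.
have [q cq qW] := mu_convex_nbhs muG W1.
(* [n] conjugates of size at most [e * tau / n] have total size at most [1 / 2] *)
pose e := (2 * l)^-1.
have e0 : 0 < e by rewrite invr_gt0; lra.
have := steps_near (compact_conj_small hE cP cq e0 d0).
move=> /nbhs_ballP[r/= r0 Hr].
(* [l / r] ensures [tau / n < r], and the summand [l] ensures [tau / n <= 1] *)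
have [N lN] : exists N, l / r + l < N%:R :> R.
  exists (Num.truncn (l / r + l)).+1; exact: truncnS_gt.
exists N => n tau Nn /=; rewrite in_itv/= => /andP[tau0 taul].
rewrite expE ?tau0//.
have [->|taun0] := eqVneq tau 0.
  rewrite mul0r mu0 expg1n P0.
  by split; exists 1%g; rewrite ?mulg1//; exact: nbhs_singleton.
have {}tau0 : 0 < tau by rewrite lt_neqAle eq_sym taun0.
have nn : l / r + l < n%:R by rewrite (lt_le_trans lN)// ler_nat.
have lr0 : 0 < l / r by rewrite divr_gt0.
have n_gt0 : (0 : R) < n%:R by lra.
set h := tau / n%:R.
have nh : n%:R * h = tau by rewrite mulrC divfK// gt_eqF.
have h0 : 0 < h by rewrite divr_gt0.
have hr : h < r.
  rewrite /h ltr_pdivrMr//; apply: (le_lt_trans taul).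
  by rewrite mulrC -ltr_pdivrMr//; lra.
have h1 : h <= 1 by rewrite ler_pdivrMr//; lra.
have H1 : forall s, 0 <= s <= b ->
    cdom (chart_at (1%g : G)) (Phi s * (mu h * (Phi h)^-1) * (Phi s)^-1)%g /\
    chart_size q (Phi s * (mu h * (Phi h)^-1) * (Phi s)^-1)%g <= e * h.
  have hball : ball (0 : R) r h by rewrite /ball/= sub0r normrN gtr0_norm.
  have h01 : 0 <= 0 + h <= 1 by rewrite add0r h1 ltW.
  by move=> s sb; have := Hr h hball (lt0r_neq0 h0) h01 s sb; rewrite gtr0_norm.
have Pk k : (k <= n)%N -> (Phi h ^+ k)%g = Phi (k%:R * h) /\ 0 <= k%:R * h <= b.
  move=> kn; have kh : k%:R * h <= tau.
    by rewrite -nh ler_wpM2r ?ler_nat// ltW.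
  have khb : k%:R * h <= b by lra.
  split; last by rewrite khb andbT mulr_ge0// ltW.
  by rewrite (additive_onX (ltW b0) aP)// ltW.
pose xs := [seq (Phi h ^+ i * (mu h * (Phi h)^-1) * (Phi h ^+ i)^-1)%g | i <- index_iota 0 n].
have [] : U (\prod_(a <- xs) a)%g /\ forall s, 0 <= s <= b ->
    U ((Phi s)^-1 * (\prod_(a <- xs) a) * Phi s)%g.
  apply: qW => [a /mapP[i]|].
    rewrite mem_index_iota => /andP[_ /ltnW/Pk[-> ib]] ->.
    exact: (H1 _ ib).1.
  rewrite big_map; apply: (@le_lt_trans _ _ (\sum_(0 <= i < n) e * h)).
    rewrite big_nat [leRHS]big_nat; apply: ler_sum => i /andP[_ /ltnW/Pk[-> ib]].
    exact: (H1 _ ib).2.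
  rewrite big_const_nat subn0 iter_addr addr0 -mulr_natr -mulrA [h * _]mulrC nh.
  by rewrite /e mulrC ltr_pdivrMr; lra.
rewrite big_map -expg_quotient; have [Pn taub] := Pk n (leqnn n); rewrite nh in Pn taub.
rewrite Pn => Uq /(_ tau taub) Uq'; split.
  by exists (mu h ^+ n * (Phi tau)^-1)%g => //; rewrite mulgVK.
exists ((Phi tau)^-1 * (mu h ^+ n * (Phi tau)^-1) * Phi tau)%g => //.
by rewrite !mulgA mulgV mul1g mulgVK.
Qed.
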